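(* Let $\mathsf{S}$ be a category with pullbacks and coproducts (respectively, with pullbacks and finite coproducts). Then the double category $\mathbb{S}\mathsf{pan}(\mathsf{S})$ of spans in $\mathsf{S}$ has colax coproducts (respectively, colax finite coproducts). Moreover, if $\mathsf{S}$ is an infinitary extensive category (respectively, a finitary extensive category), then the coproducts (respectively, the finite coproducts) in $\mathbb{S}\mathsf{pan}(\mathsf{S})$ are strong.
   Context: $\mathbb{S}\mathsf{pan}(\mathsf{S})$ is the double category whose objects and arrows are those of $\mathsf{S}$, whose proarrows are spans in $\mathsf{S}$, whose cells are maps of spans, and whose external composition is by pullback. For a category $\mathsf{S}$ with pullbacks and (finite) coproducts, being (finitary) infinitary extensive amounts to the (finite) coproducts being disjoint and stable under pullback. Double categories and double functors are pseudo unless otherwise stated. A proarrow is written $m\colon x\nrightarrow y$; a cell $\alpha\colon m\to n$ over $(f,g)$ has left side $f$ and right side $g$. For a span of sets $I\xleftarrow{\ell}A\xrightarrow{r}J$, written $A\colon I\nrightarrow J$, the notation $a\colon i\nrightarrow j$ means $a\in A$, $\ell(a)=i$, $r(a)=j$. The double category of families $\mathbb{F}\mathsf{am}(\mathbb{D})$ in a double category $\mathbb{D}$ has: - objects $(I,\underline{x})$: a set $I$ and objects $x_i$ of $\mathbb{D}$, $i\in I$; - arrows $(f_0,f)\colon(I,\underline{x})\to(J,\underline{y})$: a function $f_0\colon I\to J$ and arrows $f_i\colon x_i\to y_{f_0(i)}$; - proarrows $(A,\underline{m})\colon(I,\underline{x})\nrightarrow(J,\underline{y})$: a span of sets $A\colon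 I\nrightarrow J$ and proarrows $m_a\colon x_i\nrightarrow y_j$ for each $a\colon i\nrightarrow j$; - cells $(A,\underline{m})\to(B,\underline{n})$ over $((f_0,f),(g_0,g))$: a map of spans $(f_0,\alpha_0,g_0)$ and cells $\alpha_a\colon m_a\to n_{\alpha_0(a)}$ over $(f_i,g_j)$ for each $a\colon i\nrightarrow j$. External composition is by pullback of indexing spans and $(\underline{m}\odot\underline{n})_{(a,b)}=m_a\odot n_b$. $\mathbb{F}\mathsf{inFam}(\mathbb{D})$ uses only finite sets and spans of finite sets. $\Delta\colon\mathbb{D}\to\mathbb{F}\mathsf{am}(\mathbb{D})$ sends objects and proarrows to singleton families (indexed by $1$ and $1\leftarrow1\to1$). $\mathbb{D}$ has colax coproducts if $\Delta$ has a left adjoint $\Sigma\colon\mathbb{F}\mathsf{am}(\mathbb{D})\to\mathbb{D}$ in the 2-category of double categories, colax double functors, and natural transformations; the coproducts are strong if $\Sigma$ is a pseudo double functor. Colax and strong finite coproducts are defined likewise with $\mathbb{F}\mathsf{inFam}(\mathbb{D})$ in place of $\mathbb{F}\mathsf{am}(\mathbb{D})$. *)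

(* Defs.v *)
From Corelib Require Import ssreflect ssrfun.
From Stdlib Require Import List FunctionalExtensionality ProofIrrelevance.
From Stdlib Require Import ClassicalEpsilon Eqdep Program.Equality.
From Stdlib Require FinFun.

Set Implicit Arguments.
Unset Strict Implicit.
Unset Printing Implicit Defensive.

(* Equality of objects, arrows, proarrows and cells is Leibniz equality.
   All compositions are written in diagrammatic order. *)

Record Cat := MkCat {
  ob :> Type;
  hom : ob -> ob -> Type;
  idm : forall x, hom x x;
  comp : forall x y z, hom x y -> hom y z -> hom x z;
  comp_idl : forall x y (f : hom x y), comp (idm x) f = f;
  comp_idr : forall x y (f : hom x y), comp f (idm y) = f;
  comp_assoc : forall x y z w (f : hom x y) (g : hom y z) (h : hom z w),
    comp (comp f g) h = comp f (comp g h) }.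

Arguments idm {c} x.
Notation "f ;; g" := (comp f g) (at level 50, left associativity).

Definition is_pullback (S : Cat) (x y z p : S) (f : hom x z) (g : hom y z)
    (u : hom p x) (v : hom p y) : Prop :=
  u ;; f = v ;; g /\
  forall (w : S) (a : hom w x) (b : hom w y), a ;; f = b ;; g ->
    exists! h : hom w p, h ;; u = a /\ h ;; v = b.

Record Pullback (S : Cat) (x y z : S) (f : hom x z) (g : hom y z) := MkPullback {
  pb : S;
  pb1 : hom pb x;
  pb2 : hom pb y;
  pbP : is_pullback f g pb1 pb2 }.

Definition Pullbacks (S : Cat) :=
  forall (x y z : S) (f : hom x z) (g : hom y z), Pullback f g.

(* The universe of "sets" over which families and coproducts are indexed. *)
Definition SET := Type.

Definition is_coproduct (S : Cat) (I : SET) (x : I -> S) (c : S)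
    (inj : forall i, hom (x i) c) : Prop :=
  forall (z : S) (k : forall i, hom (x i) z),
    exists! h : hom c z, forall i, inj i ;; h = k i.

Definition is_initial (S : Cat) (p : S) : Prop :=
  forall z : S, exists! h : hom p z, True.

Definition is_mono (S : Cat) (x y : S) (f : hom x y) : Prop :=
  forall (w : S) (a b : hom w x), a ;; f = b ;; f -> a = b.

(* The set-theoretic pullback of r : A -> J and l : B -> J, as the set of
   triples (a, j, b) with r a = j = l b.  Keeping the middle component j makes
   the fibrewise description of composite spans hold by computation. *)
Record spb (A J B : SET) (r : A -> J) (l : B -> J) : SET := MkSpb {
  spb_fst : A;
  spb_mid : J;
  spb_snd : B;
  spb_eql : r spb_fst = spb_mid;
  spb_eqr : l spb_snd = spb_mid }.

(* A class of admissible index sets, so that the finite and the infinitary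
   notions are treated at once: all sets, or the finite sets. *)
Record SetClass := MkSetClass {
  in_class :> SET -> Prop;
  class_unit : in_class unit;
  class_spb : forall (A J B : SET) (r : A -> J) (l : B -> J),
    in_class A -> in_class J -> in_class B -> in_class (spb r l) }.

Definition all_sets : SetClass.
Proof. by exists (fun _ => True). Defined.

Definition finite_sets : SetClass.
Proof.
exists FinFun.Finite.
  by exists (tt :: nil); case; left.
move=> A J B r l [la FA] _ [lb FB].
pose mk (ab : A * B) : list (spb r l) :=
  match excluded_middle_informative (l (snd ab) = r (fst ab)) with
  | left e => MkSpb eq_refl e :: nil
  | right _ => nil
  end.
exists (flat_map mk (list_prod la lb)) => -[a j b ea eb].
apply/in_flat_map; exists (a, b); split; first by apply: in_prod.
rewrite /mk /=; destruct ea.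
case: excluded_middle_informative => [e|//].
by left; rewrite (proof_irrelevance _ e eb).
Defined.

Definition has_coproducts (K : SetClass) (S : Cat) : Prop :=
  forall (I : SET) (x : I -> S), K I ->
    exists (c : S) (inj : forall i, hom (x i) c), is_coproduct inj.

Definition disjoint_coproducts (K : SetClass) (S : Cat) : Prop :=
  forall (I : SET) (x : I -> S) (c : S) (inj : forall i, hom (x i) c),
    K I -> is_coproduct inj ->
    (forall i, is_mono (inj i)) /\
    (forall i j, i <> j -> forall (p : S) (u : hom p (x i)) (v : hom p (x j)),
      is_pullback (inj i) (inj j) u v -> is_initial p).

Definition stable_coproducts (K : SetClass) (S : Cat) : Prop :=
  forall (I : SET) (x : I -> S) (c : S) (inj : forall i, hom (x i) c),
    K I -> is_coproduct inj ->
    forall (y : S) (f : hom y c) (p : I -> S)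
      (u : forall i, hom (p i) y) (v : forall i, hom (p i) (x i)),
      (forall i, is_pullback f (inj i) (u i) (v i)) -> is_coproduct u.

(* For a category with pullbacks. *)
Definition extensive (K : SetClass) (S : Cat) : Prop :=
  has_coproducts K S /\ disjoint_coproducts K S /\ stable_coproducts K S.

Definition infinitary_extensive := extensive all_sets.
Definition finitary_extensive := extensive finite_sets.

Record DblData := MkDblData {
  arrcat :> Cat;
  pro : arrcat -> arrcat -> Type;
  cell : forall (x y x' y' : arrcat), pro x y -> pro x' y' ->
    hom x x' -> hom y y' -> Type;
  vid : forall x y (m : pro x y), cell m m (idm x) (idm y);
  vcomp : forall x y x' y' x'' y'' (m : pro x y) (n : pro x' y') (p : pro x'' y'')
    (f : hom x x') (g : hom y y') (f' : hom x' x'') (g' : hom y' y''),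
    cell m n f g -> cell n p f' g' -> cell m p (f ;; f') (g ;; g');
  pid : forall x, pro x x;
  pcomp : forall x y z, pro x y -> pro y z -> pro x z;
  ucell : forall x y (f : hom x y), cell (pid x) (pid y) f f;
  hcomp : forall x y z x' y' z' (m : pro x y) (n : pro y z)
    (m' : pro x' y') (n' : pro y' z')
    (f : hom x x') (g : hom y y') (h : hom z z'),
    cell m m' f g -> cell n n' g h -> cell (pcomp m n) (pcomp m' n') f h;
  assoc : forall x y z w (m : pro x y) (n : pro y z) (p : pro z w),
    cell (pcomp (pcomp m n) p) (pcomp m (pcomp n p)) (idm x) (idm w);
  assoc_inv : forall x y z w (m : pro x y) (n : pro y z) (p : pro z w),
    cell (pcomp m (pcomp n p)) (pcomp (pcomp m n) p) (idm x) (idm w);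
  lun : forall x y (m : pro x y), cell (pcomp (pid x) m) m (idm x) (idm y);
  lun_inv : forall x y (m : pro x y), cell m (pcomp (pid x) m) (idm x) (idm y);
  run : forall x y (m : pro x y), cell (pcomp m (pid y)) m (idm x) (idm y);
  run_inv : forall x y (m : pro x y), cell m (pcomp m (pid y)) (idm x) (idm y) }.

Notation "m ⊙ n" := (pcomp m n) (at level 40, left associativity).
Notation "α ⊖ β" := (hcomp α β) (at level 40, left associativity).
Notation "α • β" := (vcomp α β) (at level 50, left associativity).
Arguments pid {d} x.

(* A cell together with its boundary.  Cells whose boundaries are equal only
   propositionally (say along associativity of arrows) are compared as squares. *)
Record square (D : DblData) := Sq {
  sq_nw : D; sq_ne : D; sq_sw : D; sq_se : D;
  sq_top : pro sq_nw sq_ne;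
  sq_bot : pro sq_sw sq_se;
  sq_left : hom sq_nw sq_sw;
  sq_right : hom sq_ne sq_se;
  sq_cell : cell sq_top sq_bot sq_left sq_right }.
Arguments Sq {D} {_ _ _ _ _ _ _ _} _.

Notation "α ≡ β" := (Sq α = Sq β) (at level 70, no associativity).

Record DblCat := MkDblCat {
  dbldata :> DblData;
  vcomp_idl : forall (x y x' y' : dbldata) (m : pro x y) (n : pro x' y')
    (f : hom x x') (g : hom y y') (α : cell m n f g), vid m • α ≡ α;
  vcomp_idr : forall (x y x' y' : dbldata) (m : pro x y) (n : pro x' y')
    (f : hom x x') (g : hom y y') (α : cell m n f g), α • vid n ≡ α;
  vcomp_assoc : forall (x0 y0 x1 y1 x2 y2 x3 y3 : dbldata)
    (m0 : pro x0 y0) (m1 : pro x1 y1) (m2 : pro x2 y2) (m3 : pro x3 y3)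
    (f : hom x0 x1) (f' : hom x1 x2) (f'' : hom x2 x3)
    (g : hom y0 y1) (g' : hom y1 y2) (g'' : hom y2 y3)
    (α : cell m0 m1 f g) (β : cell m1 m2 f' g') (γ : cell m2 m3 f'' g''),
    α • β • γ ≡ α • (β • γ);
  ucell_id : forall x : dbldata, ucell (idm x) = vid (pid x);
  ucell_comp : forall (x y z : dbldata) (f : hom x y) (g : hom y z),
    ucell (f ;; g) = ucell f • ucell g;
  hcomp_id : forall (x y z : dbldata) (m : pro x y) (n : pro y z),
    vid m ⊖ vid n = vid (m ⊙ n);
  hcomp_comp : forall (x y z x' y' z' x'' y'' z'' : dbldata)
    (m : pro x y) (n : pro y z) (m' : pro x' y') (n' : pro y' z')
    (m'' : pro x'' y'') (n'' : pro y'' z'')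
    (f : hom x x') (g : hom y y') (h : hom z z')
    (f' : hom x' x'') (g' : hom y' y'') (h' : hom z' z'')
    (α : cell m m' f g) (β : cell n n' g h)
    (α' : cell m' m'' f' g') (β' : cell n' n'' g' h'),
    (α • α') ⊖ (β • β') = (α ⊖ β) • (α' ⊖ β');
  assoc_nat : forall (x y z w x' y' z' w' : dbldata)
    (m : pro x y) (n : pro y z) (p : pro z w)
    (m' : pro x' y') (n' : pro y' z') (p' : pro z' w')
    (f : hom x x') (g : hom y y') (h : hom z z') (k : hom w w')
    (α : cell m m' f g) (β : cell n n' g h) (γ : cell p p' h k),
    ((α ⊖ β) ⊖ γ) • assoc m' n' p' ≡ assoc m n p • (α ⊖ (β ⊖ γ));
  lun_nat : forall (x y x' y' : dbldata) (m : pro x y) (n : pro x' y')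
    (f : hom x x') (g : hom y y') (α : cell m n f g),
    (ucell f ⊖ α) • lun n ≡ lun m • α;
  run_nat : forall (x y x' y' : dbldata) (m : pro x y) (n : pro x' y')
    (f : hom x x') (g : hom y y') (α : cell m n f g),
    (α ⊖ ucell g) • run n ≡ run m • α;
  assocK : forall (x y z w : dbldata) (m : pro x y) (n : pro y z) (p : pro z w),
    assoc m n p • assoc_inv m n p ≡ vid ((m ⊙ n) ⊙ p);
  assocVK : forall (x y z w : dbldata) (m : pro x y) (n : pro y z) (p : pro z w),
    assoc_inv m n p • assoc m n p ≡ vid (m ⊙ (n ⊙ p));
  lunK : forall (x y : dbldata) (m : pro x y), lun m • lun_inv m ≡ vid (pid x ⊙ m);
  lunVK : forall (x y : dbldata) (m : pro x y), lun_inv m • lun m ≡ vid m;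
  runK : forall (x y : dbldata) (m : pro x y), run m • run_inv m ≡ vid (m ⊙ pid y);
  runVK : forall (x y : dbldata) (m : pro x y), run_inv m • run m ≡ vid m;
  pentagon : forall (x y z w v : dbldata)
    (m : pro x y) (n : pro y z) (p : pro z w) (q : pro w v),
    assoc (m ⊙ n) p q • assoc m n (p ⊙ q) ≡
    (assoc m n p ⊖ vid q) • assoc m (n ⊙ p) q • (vid m ⊖ assoc n p q);
  triangle : forall (x y z : dbldata) (m : pro x y) (n : pro y z),
    assoc m (pid y) n • (vid m ⊖ lun n) ≡ run m ⊖ vid n }.

Section SquareTheory.
Context {D : DblData}.
Implicit Types x y z : D.

Lemma Sq_inj x y x' y' (m : pro x y) (n : pro x' y') f g (α β : cell m n f g) :
  α ≡ β -> α = β.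
Proof. by move=> H; dependent destruction H. Qed.

Lemma vcomp_congr x y x' y' x'' y'' (m : pro x y) (n : pro x' y') (p : pro x'' y'')
    f g f' g' (α : cell m n f g) (β : cell n p f' g')
    u v u' v' u'' v'' (a : pro u v) (b : pro u' v') (c : pro u'' v'')
    h k h' k' (α' : cell a b h k) (β' : cell b c h' k') :
  α ≡ α' -> β ≡ β' -> α • β ≡ α' • β'.
Proof. by move=> H1 H2; dependent destruction H1; dependent destruction H2. Qed.

Lemma hcomp_congr x y z x' y' z' (m : pro x y) (n : pro y z)
    (m' : pro x' y') (n' : pro y' z') f g h
    (α : cell m m' f g) (β : cell n n' g h)
    u v w u' v' w' (a : pro u v) (b : pro v w)
    (a' : pro u' v') (b' : pro v' w') f' g' h'
    (α' : cell a a' f' g') (β' : cell b b' g' h') :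
  α ≡ α' -> β ≡ β' -> α ⊖ β ≡ α' ⊖ β'.
Proof. by move=> H1 H2; dependent destruction H1; dependent destruction H2. Qed.

Definition cast_cell x y x' y' (m : pro x y) (n : pro x' y') f f' g g'
    (ef : f = f') (eg : g = g') (α : cell m n f g) : cell m n f' g' :=
  match ef in _ = f0, eg in _ = g0 return cell m n f0 g0 with
  | eq_refl, eq_refl => α
  end.

Lemma cast_cellE x y x' y' (m : pro x y) (n : pro x' y') f f' g g'
    (ef : f = f') (eg : g = g') (α : cell m n f g) : cast_cell ef eg α ≡ α.
Proof. by destruct ef, eg. Qed.

End SquareTheory.

Record ColaxData (D E : DblCat) := MkColaxData {
  fob :> D -> E;
  farr : forall x y : D, hom x y -> hom (fob x) (fob y);
  fpro : forall x y : D, pro x y -> pro (fob x) (fob y);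
  fcell : forall (x y x' y' : D) (m : pro x y) (n : pro x' y')
    (f : hom x x') (g : hom y y'),
    cell m n f g -> cell (fpro m) (fpro n) (farr f) (farr g);
  fmul : forall (x y z : D) (m : pro x y) (n : pro y z),
    cell (fpro (m ⊙ n)) (fpro m ⊙ fpro n) (idm (fob x)) (idm (fob z));
  funit : forall x : D,
    cell (fpro (pid x)) (pid (fob x)) (idm (fob x)) (idm (fob x)) }.

Record ColaxFunctor (D E : DblCat) := MkColaxFunctor {
  cfdata :> ColaxData D E;
  farr_id : forall x : D, farr cfdata (idm x) = idm (cfdata x);
  farr_comp : forall (x y z : D) (f : hom x y) (g : hom y z),
    farr cfdata (f ;; g) = farr cfdata f ;; farr cfdata g;
  fcell_id : forall (x y : D) (m : pro x y),
    fcell cfdata (vid m) ≡ vid (fpro cfdata m);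
  fcell_comp : forall (x y x' y' x'' y'' : D)
    (m : pro x y) (n : pro x' y') (p : pro x'' y'')
    (f : hom x x') (g : hom y y') (f' : hom x' x'') (g' : hom y' y'')
    (α : cell m n f g) (β : cell n p f' g'),
    fcell cfdata (α • β) ≡ fcell cfdata α • fcell cfdata β;
  fmul_nat : forall (x y z x' y' z' : D) (m : pro x y) (n : pro y z)
    (m' : pro x' y') (n' : pro y' z')
    (f : hom x x') (g : hom y y') (h : hom z z')
    (α : cell m m' f g) (β : cell n n' g h),
    fcell cfdata (α ⊖ β) • fmul cfdata m' n' ≡
    fmul cfdata m n • (fcell cfdata α ⊖ fcell cfdata β);
  funit_nat : forall (x y : D) (f : hom x y),
    fcell cfdata (ucell f) • funit cfdata y ≡
    funit cfdata x • ucell (farr cfdata f);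
  fmul_assoc : forall (x y z w : D) (m : pro x y) (n : pro y z) (p : pro z w),
    fmul cfdata (m ⊙ n) p • (fmul cfdata m n ⊖ vid (fpro cfdata p)) •
      assoc (fpro cfdata m) (fpro cfdata n) (fpro cfdata p) ≡
    fcell cfdata (assoc m n p) • fmul cfdata m (n ⊙ p) •
      (vid (fpro cfdata m) ⊖ fmul cfdata n p);
  fmul_lun : forall (x y : D) (m : pro x y),
    fmul cfdata (pid x) m • (funit cfdata x ⊖ vid (fpro cfdata m)) •
      lun (fpro cfdata m) ≡ fcell cfdata (lun m);
  fmul_run : forall (x y : D) (m : pro x y),
    fmul cfdata m (pid y) • (vid (fpro cfdata m) ⊖ funit cfdata y) •
      run (fpro cfdata m) ≡ fcell cfdata (run m) }.

Definition cell_invertible (D : DblCat) (x y : D) (m n : pro x y)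
    (α : cell m n (idm x) (idm y)) : Prop :=
  exists β : cell n m (idm x) (idm y), α • β ≡ vid m /\ β • α ≡ vid n.

Definition is_pseudo (D E : DblCat) (F : ColaxFunctor D E) : Prop :=
  (forall (x y z : D) (m : pro x y) (n : pro y z), cell_invertible (fmul F m n)) /\
  (forall x : D, cell_invertible (funit F x)).

Section ColaxComposition.

Lemma fcell_congr (D E : DblCat) (F : ColaxFunctor D E)
    (x y x' y' : D) (m : pro x y) (n : pro x' y') f g (α : cell m n f g)
    (u v u' v' : D) (a : pro u v) (b : pro u' v') h k (β : cell a b h k) :
  α ≡ β -> fcell F α ≡ fcell F β.
Proof. by move=> H; dependent destruction H. Qed.

Lemma vmid (D : DblCat) (x0 y0 x1 y1 x2 y2 x2' y2' x3 y3 : D) (m0 : pro x0 y0) (m1 : pro x1 y1)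
    (m2 : pro x2 y2) (m2' : pro x2' y2') (m3 : pro x3 y3)
    f g h k (ω : cell m0 m1 f g) (α : cell m1 m2 h k)
    f1 g1 (β : cell m2 m3 f1 g1)
    h' k' (γ : cell m1 m2' h' k') f2 g2 (δ : cell m2' m3 f2 g2) :
  α • β ≡ γ • δ -> ω • α • β ≡ ω • γ • δ.
Proof.
move=> H; apply: etrans (vcomp_assoc _ _ _) _; apply: esym.
by apply: etrans (vcomp_assoc _ _ _) _; apply: vcomp_congr.
Qed.

Lemma vassoc3 (D : DblCat) (x0 y0 x1 y1 x2 y2 x3 y3 x4 y4 : D) (m0 : pro x0 y0)
    (m1 : pro x1 y1) (m2 : pro x2 y2) (m3 : pro x3 y3) (m4 : pro x4 y4)
    f0 g0 f1 g1 f2 g2 f3 g3 (ω : cell m0 m1 f0 g0) (α : cell m1 m2 f1 g1)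
    (β : cell m2 m3 f2 g2) (γ : cell m3 m4 f3 g3) :
  ω • α • β • γ ≡ ω • (α • β • γ).
Proof.
apply: etrans (vcomp_congr (vcomp_assoc _ _ _) (erefl _)) _.
exact: vcomp_assoc.
Qed.

Definition colax_id_data (D : DblCat) : ColaxData D D :=
  @MkColaxData D D (fun x => x) (fun _ _ f => f) (fun _ _ m => m)
    (fun _ _ _ _ _ _ _ _ α => α) (fun _ _ _ m n => vid (m ⊙ n))
    (fun x => vid (pid x)).

Lemma vcomp_idr' (D : DblCat) (x y x' y' : D) (m : pro x y) (n n' : pro x' y')
    f g h k (α : cell m n f g) (i : cell n n' h k) : i ≡ vid n -> α • i ≡ α.
Proof.
by move=> ei; exact: etrans (vcomp_congr (erefl (Sq α)) ei) (vcomp_idr α).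
Qed.

Lemma vcomp_idl' (D : DblCat) (x y x' y' : D) (m' m : pro x y) (n : pro x' y')
    f g h k (α : cell m n f g) (i : cell m' m h k) : i ≡ vid m -> i • α ≡ α.
Proof.
by move=> ei; exact: etrans (vcomp_congr ei (erefl (Sq α))) (vcomp_idl α).
Qed.

Lemma hcomp_id' (D : DblCat) (x y z : D) (m : pro x y) (n : pro y z) :
  vid m ⊖ vid n ≡ vid (m ⊙ n).
Proof. by rewrite hcomp_id. Qed.

Definition colax_id (D : DblCat) : ColaxFunctor D D.
Proof.
exists (colax_id_data D) => //=.
- by move=> *; exact: etrans (vcomp_idr _) (esym (vcomp_idl _)).
- by move=> *; exact: etrans (vcomp_idr _) (esym (vcomp_idl _)).
- move=> x y z w m n p; transitivity (Sq (assoc m n p)).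
    by apply: vcomp_idl'; apply: etrans (vcomp_idl _) (hcomp_id' _ _).
  apply: esym; apply: etrans (vcomp_idr' _ (hcomp_id' _ _)) _.
  exact: vcomp_idr.
- by move=> x y m; apply: vcomp_idl'; apply: etrans (vcomp_idl _) (hcomp_id' _ _).
- by move=> x y m; apply: vcomp_idl'; apply: etrans (vcomp_idl _) (hcomp_id' _ _).
Defined.

Context {D E G : DblCat} (F1 : ColaxFunctor D E) (F2 : ColaxFunctor E G).

Lemma comp_cast_eq (z : E) : farr F2 (idm z) ;; idm (F2 z) = idm (F2 z).
Proof. by rewrite farr_id comp_idl. Qed.

(* The comparison cells F2 (F1 (m ⊙ n)) -> F2 (F1 m ⊙ F1 n) -> F2 (F1 m) ⊙ F2 (F1 n)
   lie over F2 id ;; id, hence the casts. *)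
Definition colax_comp_data : ColaxData D G :=
  @MkColaxData D G (fun x => F2 (F1 x)) (fun _ _ f => farr F2 (farr F1 f))
    (fun _ _ m => fpro F2 (fpro F1 m))
    (fun _ _ _ _ _ _ _ _ α => fcell F2 (fcell F1 α))
    (fun x y z m n => cast_cell (comp_cast_eq (F1 x)) (comp_cast_eq (F1 z))
      (fcell F2 (fmul F1 m n) • fmul F2 (fpro F1 m) (fpro F1 n)))
    (fun x => cast_cell (comp_cast_eq (F1 x)) (comp_cast_eq (F1 x))
      (fcell F2 (funit F1 x) • funit F2 (F1 x))).

End ColaxComposition.

Definition colax_comp (D E G : DblCat) (F1 : ColaxFunctor D E)
  (F2 : ColaxFunctor E G) : ColaxFunctor D G.
Proof.
exists (colax_comp_data F1 F2) => /=.
- by move=> x; rewrite !farr_id.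
- by move=> x y z f g; rewrite !farr_comp.
- by move=> x y m; exact: etrans (fcell_congr _ (fcell_id _ _)) (fcell_id _ _).
- by move=> *; exact: etrans (fcell_congr _ (fcell_comp _ _ _)) (fcell_comp _ _ _).
- move=> x y z x' y' z' m n m' n' f g h α β.
  transitivity (Sq (fcell F2 (fcell F1 (α ⊖ β)) • fcell F2 (fmul F1 m' n') •
      fmul F2 (fpro F1 m') (fpro F1 n'))).
    by rewrite vcomp_assoc; apply: vcomp_congr => //; exact: cast_cellE.
  transitivity (Sq (fcell F2 (fmul F1 m n) • fcell F2 (fcell F1 α ⊖ fcell F1 β) •
      fmul F2 (fpro F1 m') (fpro F1 n'))).
    apply: vcomp_congr => //; rewrite -!fcell_comp.
    by apply: fcell_congr; exact: fmul_nat.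
  apply: etrans (vmid _ (fmul_nat _ _ _)) _; apply: vcomp_congr => //.
  by rewrite cast_cellE.
- move=> x y f.
  transitivity (Sq (fcell F2 (fcell F1 (ucell f)) • fcell F2 (funit F1 y) •
      funit F2 (F1 y))).
    by rewrite vcomp_assoc; apply: vcomp_congr => //; exact: cast_cellE.
  transitivity (Sq (fcell F2 (funit F1 x) • fcell F2 (ucell (farr F1 f)) •
      funit F2 (F1 y))).
    apply: vcomp_congr => //; rewrite -!fcell_comp.
    by apply: fcell_congr; exact: funit_nat.
  apply: etrans (vmid _ (funit_nat _ _)) _; apply: vcomp_congr => //.
  by rewrite cast_cellE.
- move=> x y z w m n p.
  have split : cast_cell (comp_cast_eq F2 (F1 x)) (comp_cast_eq F2 (F1 z))
        (fcell F2 (fmul F1 m n) • fmul F2 (fpro F1 m) (fpro F1 n)) ⊖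
        vid (fpro F2 (fpro F1 p)) ≡
      (fcell F2 (fmul F1 m n) ⊖ fcell F2 (vid (fpro F1 p))) •
      (fmul F2 (fpro F1 m) (fpro F1 n) ⊖ vid (fpro F2 (fpro F1 p))).
    rewrite -hcomp_comp; apply: hcomp_congr; first exact: cast_cellE.
    apply: esym; apply: etrans (vcomp_congr (fcell_id _ _) (erefl _)) _.
    exact: vcomp_idl.
  have split' : vid (fpro F2 (fpro F1 m)) ⊖
        cast_cell (comp_cast_eq F2 (F1 y)) (comp_cast_eq F2 (F1 w))
        (fcell F2 (fmul F1 n p) • fmul F2 (fpro F1 n) (fpro F1 p)) ≡
      (fcell F2 (vid (fpro F1 m)) ⊖ fcell F2 (fmul F1 n p)) •
      (vid (fpro F2 (fpro F1 m)) ⊖ fmul F2 (fpro F1 n) (fpro F1 p)).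
    rewrite -hcomp_comp; apply: hcomp_congr; last exact: cast_cellE.
    apply: esym; apply: etrans (vcomp_congr (fcell_id _ _) (erefl _)) _.
    exact: vcomp_idl.
  apply: etrans (vcomp_congr (vcomp_congr (cast_cellE _ _ _) split) (erefl _)) _.
  apply: etrans (vcomp_congr (esym (vcomp_assoc _ _ _)) (erefl _)) _.
  apply: etrans (vcomp_congr (vcomp_congr (vmid _ (esym (fmul_nat _ _ _)))
    (erefl _)) (erefl _)) _.
  apply: etrans (vassoc3 _ _ _ _) _.
  apply: etrans (vcomp_congr (erefl _) (fmul_assoc _ _ _ _)) _.
  apply: etrans (esym (vassoc3 _ _ _ _)) _.
  have key : fcell F2 (fmul F1 (m ⊙ n) p) •
        fcell F2 (fmul F1 m n ⊖ vid (fpro F1 p)) •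
        fcell F2 (assoc (fpro F1 m) (fpro F1 n) (fpro F1 p)) ≡
      fcell F2 (fcell F1 (assoc m n p)) • fcell F2 (fmul F1 m (n ⊙ p)) •
        fcell F2 (vid (fpro F1 m) ⊖ fmul F1 n p).
    apply: etrans (vcomp_congr (esym (fcell_comp _ _ _)) (erefl _)) _.
    rewrite -fcell_comp; apply: etrans (fcell_congr _ (fmul_assoc _ _ _ _)) _.
    rewrite fcell_comp; apply: vcomp_congr => //; exact: fcell_comp.
  apply: etrans (vcomp_congr (vcomp_congr key (erefl _)) (erefl _)) _.
  apply: etrans (vcomp_congr (vmid _ (fmul_nat _ _ _)) (erefl _)) _.
  apply: etrans (vcomp_assoc _ _ _) _; apply: vcomp_congr (esym split').
  apply: etrans (vcomp_assoc _ _ _) _; apply: vcomp_congr => //.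
  by rewrite cast_cellE.
- move=> x y m.
  have split : cast_cell (comp_cast_eq F2 (F1 x)) (comp_cast_eq F2 (F1 x))
        (fcell F2 (funit F1 x) • funit F2 (F1 x)) ⊖ vid (fpro F2 (fpro F1 m)) ≡
      (fcell F2 (funit F1 x) ⊖ fcell F2 (vid (fpro F1 m))) •
      (funit F2 (F1 x) ⊖ vid (fpro F2 (fpro F1 m))).
    rewrite -hcomp_comp; apply: hcomp_congr; first exact: cast_cellE.
    apply: esym; apply: etrans (vcomp_congr (fcell_id _ _) (erefl _)) _.
    exact: vcomp_idl.
  apply: etrans (vcomp_congr (vcomp_congr (cast_cellE _ _ _) split) (erefl _)) _.
  apply: etrans (vcomp_congr (esym (vcomp_assoc _ _ _)) (erefl _)) _.
  apply: etrans (vcomp_congr (vcomp_congr (vmid _ (esym (fmul_nat _ _ _)))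
    (erefl _)) (erefl _)) _.
  apply: etrans (vassoc3 _ _ _ _) _.
  apply: etrans (vcomp_congr (erefl _) (fmul_lun _ _)) _.
  apply: etrans (vcomp_congr (esym (fcell_comp _ _ _)) (erefl _)) _.
  by rewrite -fcell_comp; apply: fcell_congr; exact: fmul_lun.
- move=> x y m.
  have split : vid (fpro F2 (fpro F1 m)) ⊖
        cast_cell (comp_cast_eq F2 (F1 y)) (comp_cast_eq F2 (F1 y))
        (fcell F2 (funit F1 y) • funit F2 (F1 y)) ≡
      (fcell F2 (vid (fpro F1 m)) ⊖ fcell F2 (funit F1 y)) •
      (vid (fpro F2 (fpro F1 m)) ⊖ funit F2 (F1 y)).
    rewrite -hcomp_comp; apply: hcomp_congr; last exact: cast_cellE.
    apply: esym; apply: etrans (vcomp_congr (fcell_id _ _) (erefl _)) _.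
    exact: vcomp_idl.
  apply: etrans (vcomp_congr (vcomp_congr (cast_cellE _ _ _) split) (erefl _)) _.
  apply: etrans (vcomp_congr (esym (vcomp_assoc _ _ _)) (erefl _)) _.
  apply: etrans (vcomp_congr (vcomp_congr (vmid _ (esym (fmul_nat _ _ _)))
    (erefl _)) (erefl _)) _.
  apply: etrans (vassoc3 _ _ _ _) _.
  apply: etrans (vcomp_congr (erefl _) (fmul_run _ _)) _.
  apply: etrans (vcomp_congr (esym (fcell_comp _ _ _)) (erefl _)) _.
  by rewrite -fcell_comp; apply: fcell_congr; exact: fmul_run.
Defined.

Record NatTrans (D E : DblCat) (F G : ColaxFunctor D E) := MkNatTrans {
  nt_ob :> forall x : D, hom (F x) (G x);
  nt_pro : forall (x y : D) (m : pro x y),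
    cell (fpro F m) (fpro G m) (nt_ob x) (nt_ob y);
  nt_arr_nat : forall (x y : D) (f : hom x y),
    farr F f ;; nt_ob y = nt_ob x ;; farr G f;
  nt_cell_nat : forall (x y x' y' : D) (m : pro x y) (n : pro x' y')
    (f : hom x x') (g : hom y y') (α : cell m n f g),
    fcell F α • nt_pro n ≡ nt_pro m • fcell G α;
  nt_mul : forall (x y z : D) (m : pro x y) (n : pro y z),
    fmul F m n • (nt_pro m ⊖ nt_pro n) ≡ nt_pro (m ⊙ n) • fmul G m n;
  nt_unit : forall x : D,
    funit F x • ucell (nt_ob x) ≡ nt_pro (pid x) • funit G x }.

(* The colax double functor L is left adjoint to R in the 2-category of double
   categories, colax double functors and natural transformations.  The triangle
   identities are equalities of natural transformations, stated componentwise
   on objects and on proarrows. *)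
Record Adjunction (D E : DblCat) (L : ColaxFunctor D E) (R : ColaxFunctor E D) :=
    MkAdjunction {
  adj_unit : NatTrans (colax_id D) (colax_comp L R);
  adj_counit : NatTrans (colax_comp R L) (colax_id E);
  adj_triangleL : forall x : D,
    farr L (adj_unit x) ;; adj_counit (L x) = idm (L x);
  adj_triangleL_pro : forall (x y : D) (m : pro x y),
    fcell L (nt_pro adj_unit m) • nt_pro adj_counit (fpro L m) ≡ vid (fpro L m);
  adj_triangleR : forall y : E,
    adj_unit (R y) ;; farr R (adj_counit y) = idm (R y);
  adj_triangleR_pro : forall (x y : E) (m : pro x y),
    nt_pro adj_unit (fpro R m) • fcell R (nt_pro adj_counit m) ≡ vid (fpro R m) }.

Section Span.
Context (S : Cat) (P : Pullbacks S).

Section Mediating.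
Context (x y z : S) (f : hom x z) (g : hom y z).

Lemma pb_comm : pb1 (P f g) ;; f = pb2 (P f g) ;; g.
Proof. by case: (pbP (P f g)). Qed.

Definition pb_med_sig (w : S) (a : hom w x) (b : hom w y) (e : a ;; f = b ;; g) :
    {h : hom w (pb (P f g)) | h ;; pb1 (P f g) = a /\ h ;; pb2 (P f g) = b} :=
  constructive_definite_description _ (proj2 (pbP (P f g)) w a b e).

Definition pb_med (w : S) (a : hom w x) (b : hom w y) (e : a ;; f = b ;; g) :
  hom w (pb (P f g)) := proj1_sig (pb_med_sig e).

Lemma pb_med1 (w : S) (a : hom w x) (b : hom w y) (e : a ;; f = b ;; g) :
  pb_med e ;; pb1 (P f g) = a.
Proof. exact: proj1 (proj2_sig (pb_med_sig e)). Qed.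

Lemma pb_med2 (w : S) (a : hom w x) (b : hom w y) (e : a ;; f = b ;; g) :
  pb_med e ;; pb2 (P f g) = b.
Proof. exact: proj2 (proj2_sig (pb_med_sig e)). Qed.

Lemma pb_ext (w : S) (h k : hom w (pb (P f g))) :
  h ;; pb1 (P f g) = k ;; pb1 (P f g) -> h ;; pb2 (P f g) = k ;; pb2 (P f g) -> h = k.
Proof.
move=> e1 e2; have e : (k ;; pb1 (P f g)) ;; f = (k ;; pb2 (P f g)) ;; g.
  by rewrite !comp_assoc pb_comm.
have [h0 [_ u]] := proj2 (pbP (P f g)) w _ _ e.
by rewrite -(u h) // -(u k).
Qed.

End Mediating.

Lemma pb_med1A (x y z w v : S) (f : hom x z) (g : hom y z) (a : hom w x) (b : hom w y)
    (e : a ;; f = b ;; g) (k : hom x v) :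
  pb_med e ;; (pb1 (P f g) ;; k) = a ;; k.
Proof. by rewrite -comp_assoc pb_med1. Qed.

Lemma pb_med2A (x y z w v : S) (f : hom x z) (g : hom y z) (a : hom w x) (b : hom w y)
    (e : a ;; f = b ;; g) (k : hom y v) :
  pb_med e ;; (pb2 (P f g) ;; k) = b ;; k.
Proof. by rewrite -comp_assoc pb_med2. Qed.

Lemma pb_commA (x y z v : S) (f : hom x z) (g : hom y z) (k : hom z v) :
  pb1 (P f g) ;; (f ;; k) = pb2 (P f g) ;; (g ;; k).
Proof. by rewrite -!comp_assoc pb_comm. Qed.

Record span (x y : S) := MkSpan {
  sp_apex : S;
  sp_l : hom sp_apex x;
  sp_r : hom sp_apex y }.

Record span_map (x y x' y' : S) (m : span x y) (n : span x' y')
    (f : hom x x') (g : hom y y') := MkSpanMap {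
  sm_map : hom (sp_apex m) (sp_apex n);
  sm_l : sm_map ;; sp_l n = sp_l m ;; f;
  sm_r : sm_map ;; sp_r n = sp_r m ;; g }.

Definition span_id (x : S) : span x x := MkSpan (idm x) (idm x).

Definition span_comp (x y z : S) (m : span x y) (n : span y z) : span x z :=
  MkSpan (pb1 (P (sp_r m) (sp_l n)) ;; sp_l m) (pb2 (P (sp_r m) (sp_l n)) ;; sp_r n).

Definition span_vid (x y : S) (m : span x y) : span_map m m (idm x) (idm y).
Proof. by exists (idm _); rewrite comp_idl comp_idr. Defined.

Definition span_vcomp (x y x' y' x'' y'' : S)
    (m : span x y) (n : span x' y') (p : span x'' y'')
    (f : hom x x') (g : hom y y') (f' : hom x' x'') (g' : hom y' y'')
    (α : span_map m n f g) (β : span_map n p f' g') :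
  span_map m p (f ;; f') (g ;; g').
Proof.
exists (sm_map α ;; sm_map β).
- by rewrite comp_assoc sm_l -comp_assoc sm_l comp_assoc.
- by rewrite comp_assoc sm_r -comp_assoc sm_r comp_assoc.
Defined.

Definition span_ucell (x y : S) (f : hom x y) :
  span_map (span_id x) (span_id y) f f.
Proof. by exists f; rewrite /= comp_idl comp_idr. Defined.

Lemma span_hcomp_comm (x y z x' y' z' : S) (m : span x y) (n : span y z)
    (m' : span x' y') (n' : span y' z')
    (f : hom x x') (g : hom y y') (h : hom z z')
    (α : span_map m m' f g) (β : span_map n n' g h) :
  pb1 (P (sp_r m) (sp_l n)) ;; sm_map α ;; sp_r m' =
  pb2 (P (sp_r m) (sp_l n)) ;; sm_map β ;; sp_l n'.
Proof. by rewrite !comp_assoc sm_r sm_l pb_commA. Qed.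

Definition span_hcomp (x y z x' y' z' : S) (m : span x y) (n : span y z)
    (m' : span x' y') (n' : span y' z')
    (f : hom x x') (g : hom y y') (h : hom z z')
    (α : span_map m m' f g) (β : span_map n n' g h) :
  span_map (span_comp m n) (span_comp m' n') f h.
Proof.
exists (pb_med (span_hcomp_comm α β)).
- by rewrite /= pb_med1A !comp_assoc sm_l.
- by rewrite /= pb_med2A !comp_assoc sm_r.
Defined.

Section Assoc.
Context (x y z w : S) (m : span x y) (n : span y z) (p : span z w).

Lemma span_assoc_comm2 :
  pb1 (P (sp_r (span_comp m n)) (sp_l p)) ;; pb2 (P (sp_r m) (sp_l n)) ;; sp_r n =
  pb2 (P (sp_r (span_comp m n)) (sp_l p)) ;; sp_l p.
Proof. by rewrite -pb_comm comp_assoc. Qed.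

Lemma span_assoc_comm :
  pb1 (P (sp_r (span_comp m n)) (sp_l p)) ;; pb1 (P (sp_r m) (sp_l n)) ;; sp_r m =
  pb_med span_assoc_comm2 ;; sp_l (span_comp n p).
Proof. by rewrite /= pb_med1A !comp_assoc pb_comm. Qed.

Definition span_assoc :
  span_map (span_comp (span_comp m n) p) (span_comp m (span_comp n p)) (idm x) (idm w).
Proof.
exists (pb_med span_assoc_comm).
- by rewrite /= pb_med1A comp_idr !comp_assoc.
- by rewrite /= pb_med2A pb_med2A comp_idr.
Defined.

Lemma span_assoc_inv_comm1 :
  pb1 (P (sp_r m) (sp_l (span_comp n p))) ;; sp_r m =
  pb2 (P (sp_r m) (sp_l (span_comp n p))) ;; pb1 (P (sp_r n) (sp_l p)) ;; sp_l n.
Proof. by rewrite pb_comm comp_assoc. Qed.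

Lemma span_assoc_inv_comm :
  pb_med span_assoc_inv_comm1 ;; sp_r (span_comp m n) =
  pb2 (P (sp_r m) (sp_l (span_comp n p))) ;; pb2 (P (sp_r n) (sp_l p)) ;; sp_l p.
Proof. by rewrite /= pb_med2A !comp_assoc pb_comm. Qed.

Definition span_assoc_inv :
  span_map (span_comp m (span_comp n p)) (span_comp (span_comp m n) p) (idm x) (idm w).
Proof.
exists (pb_med span_assoc_inv_comm).
- by rewrite /= pb_med1A pb_med1A comp_idr.
- by rewrite /= pb_med2A comp_idr !comp_assoc.
Defined.

End Assoc.

Section Unitors.
Context (x y : S) (m : span x y).

Definition span_lun : span_map (span_comp (span_id x) m) m (idm x) (idm y).
Proof.
exists (pb2 (P (idm x) (sp_l m))); rewrite /= !comp_idr //.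
by rewrite -pb_comm comp_idr.
Defined.

Lemma span_lun_inv_comm : sp_l m ;; idm x = idm _ ;; sp_l m.
Proof. by rewrite comp_idl comp_idr. Qed.

Definition span_lun_inv : span_map m (span_comp (span_id x) m) (idm x) (idm y).
Proof.
exists (pb_med span_lun_inv_comm).
- by rewrite /= pb_med1A.
- by rewrite /= pb_med2A comp_idl comp_idr.
Defined.

Definition span_run : span_map (span_comp m (span_id y)) m (idm x) (idm y).
Proof.
exists (pb1 (P (sp_r m) (idm y))); rewrite /= !comp_idr //.
by rewrite pb_comm comp_idr.
Defined.

Lemma span_run_inv_comm : idm _ ;; sp_r m = sp_r m ;; idm y.
Proof. by rewrite comp_idl comp_idr. Qed.

Definition span_run_inv : span_map m (span_comp m (span_id y)) (idm x) (idm y).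
Proof.
exists (pb_med span_run_inv_comm).
- by rewrite /= pb_med1A comp_idl comp_idr.
- by rewrite /= pb_med2A.
Defined.

End Unitors.

Definition span_data : DblData :=
  @MkDblData S span span_map span_vid span_vcomp span_id span_comp
    span_ucell span_hcomp span_assoc span_assoc_inv
    span_lun span_lun_inv span_run span_run_inv.

Lemma span_map_eq (x y x' y' : S) (m : span x y) (n : span x' y') f f' g g'
    (α : span_map m n f g) (β : span_map m n f' g') :
  f = f' -> g = g' -> sm_map α = sm_map β -> @Sq span_data _ _ _ _ m n f g α = @Sq span_data _ _ _ _ m n f' g' β.
Proof.
move=> ef eg; subst f' g'; case: α β => [h hl hr] [h' hl' hr'] /= eh; subst h'.
by rewrite (proof_irrelevance _ hl hl') (proof_irrelevance _ hr hr').
Qed.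

Ltac span_simp := rewrite /= ?comp_assoc; repeat first
  [ rewrite !pb_med1A | rewrite !pb_med2A | rewrite !pb_med1 | rewrite !pb_med2
  | rewrite !comp_idl | rewrite !comp_idr | progress rewrite /= !comp_assoc ].
Ltac span_ext := apply: pb_ext; span_simp; try reflexivity.

Definition Span : DblCat.
Proof.
exists span_data => *; try (apply: (@Sq_inj span_data)); apply: span_map_eq;
  rewrite ?comp_idl ?comp_idr ?comp_assoc //=;
  rewrite ?comp_idl ?comp_idr ?comp_assoc //=.
- by span_ext.
- by span_ext.
- by span_ext; span_ext.
- by rewrite pb_med2.
- by rewrite pb_med1.
- by span_ext; span_ext.
- by span_ext; span_ext.
- apply: pb_ext; rewrite /= comp_assoc ?pb_med1 ?pb_med2 comp_idl ?comp_idr //.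
  by rewrite -pb_comm comp_idr.
- by rewrite pb_med2.
- apply: pb_ext; rewrite /= comp_assoc ?pb_med1 ?pb_med2 comp_idl ?comp_idr //.
  by rewrite pb_comm comp_idr.
- by rewrite pb_med1.
- by span_ext; span_ext; span_ext.
- by span_ext; span_ext.
Defined.

End Span.

Record set_span (I J : SET) := MkSetSpan {
  ss_apex : SET;
  ss_l : ss_apex -> I;
  ss_r : ss_apex -> J }.

(* elt A i j is the set of elements a : i -/-> j of the span A. *)
Record elt (I J : SET) (A : set_span I J) (i : I) (j : J) : SET := Elt {
  elt_val : ss_apex A;
  elt_l : ss_l elt_val = i;
  elt_r : ss_r elt_val = j }.

Record set_span_map (I J I' J' : SET) (A : set_span I J) (B : set_span I' J')
    (f : I -> I') (g : J -> J') := MkSetSpanMap {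
  ssm_map :> ss_apex A -> ss_apex B;
  ssm_l : forall a, ss_l (ssm_map a) = f (ss_l a);
  ssm_r : forall a, ss_r (ssm_map a) = g (ss_r a) }.

Definition elt_map (I J I' J' : SET) (A : set_span I J) (B : set_span I' J')
    (f : I -> I') (g : J -> J') (φ : set_span_map A B f g)
    (i : I) (j : J) (a : elt A i j) : elt B (f i) (g j) :=
  Elt (eq_trans (ssm_l φ (elt_val a)) (f_equal f (elt_l a)))
       (eq_trans (ssm_r φ (elt_val a)) (f_equal g (elt_r a))).

Definition set_span_id (I : SET) : set_span I I :=
  @MkSetSpan I I I (fun i => i) (fun i => i).

Definition set_span_comp (I J L : SET) (A : set_span I J) (B : set_span J L) :
    set_span I L :=
  @MkSetSpan I L (spb (@ss_r _ _ A) (@ss_l _ _ B))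
    (fun c => ss_l (spb_fst c)) (fun c => ss_r (spb_snd c)).

(* An element i -/-> l of a composite is a pair of a : i -/-> j and b : j -/-> l,
   where j is the middle component. *)
Section CompositeElements.
Context (I J L : SET) (A : set_span I J) (B : set_span J L) (i : I) (l : L).

Definition elt_mid (c : elt (set_span_comp A B) i l) : J := spb_mid (elt_val c).

Definition elt_fst (c : elt (set_span_comp A B) i l) : elt A i (elt_mid c) :=
  @Elt _ _ A i (elt_mid c) (spb_fst (elt_val c)) (elt_l c) (spb_eql (elt_val c)).

Definition elt_snd (c : elt (set_span_comp A B) i l) : elt B (elt_mid c) l :=
  @Elt _ _ B (elt_mid c) l (spb_snd (elt_val c)) (spb_eqr (elt_val c)) (elt_r c).

End CompositeElements.

Section Fam.
Context (K : SetClass) (D : DblCat).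

Record fam_ob := MkFamOb {
  fam_idx : SET;
  fam_idxP : K fam_idx;
  fam_pt :> fam_idx -> D }.

Record fam_arr (X Y : fam_ob) := MkFamArr {
  fa_idx :> fam_idx X -> fam_idx Y;
  fa_arr : forall i, hom (X i) (Y (fa_idx i)) }.

Record fam_pro (X Y : fam_ob) := MkFamPro {
  fp_span : set_span (fam_idx X) (fam_idx Y);
  fp_spanP : K (ss_apex fp_span);
  fp_pro : forall i j, elt fp_span i j -> pro (X i) (Y j) }.

Record fam_cell (X Y X' Y' : fam_ob) (M : fam_pro X Y) (N : fam_pro X' Y')
    (F : fam_arr X X') (G : fam_arr Y Y') := MkFamCell {
  fc_map : set_span_map (fp_span M) (fp_span N) F G;
  fc_cell : forall i j (a : elt (fp_span M) i j),
    cell (fp_pro a) (fp_pro (elt_map fc_map a)) (fa_arr F i) (fa_arr G j) }.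

Definition fam_idm (X : fam_ob) : fam_arr X X :=
  @MkFamArr X X (fun i => i) (fun i => idm (X i)).

Definition fam_comp (X Y Z : fam_ob) (F : fam_arr X Y) (G : fam_arr Y Z) : fam_arr X Z :=
  @MkFamArr X Z (fun i => G (F i)) (fun i => fa_arr F i ;; fa_arr G (F i)).

Lemma fam_arr_ext (X Y : fam_ob) (f0 : fam_idx X -> fam_idx Y)
    (f f' : forall i, hom (X i) (Y (f0 i))) :
  (forall i, f i = f' i) -> MkFamArr f = MkFamArr f'.
Proof. by move=> e; f_equal; apply: functional_extensionality_dep. Qed.

Definition fam_cat : Cat.
Proof.
exists fam_ob fam_arr fam_idm fam_comp => /=.
- by move=> X Y [f0 f]; apply: fam_arr_ext => i /=; exact: comp_idl.
- by move=> X Y [f0 f]; apply: fam_arr_ext => i /=; exact: comp_idr.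
- by move=> *; apply: fam_arr_ext => i /=; exact: comp_assoc.
Defined.

Definition fam_pid (X : fam_ob) : fam_pro X X :=
  @MkFamPro X X (set_span_id (fam_idx X)) (fam_idxP X)
    (fun i j (a : elt (set_span_id (fam_idx X)) i j) =>
      match a with
      | @Elt _ _ _ _ _ k p q =>
        match p in _ = i', q in _ = j' return pro (X i') (X j') with
        | eq_refl, eq_refl => pid (X k)
        end
      end).

Definition fam_pcomp (X Y Z : fam_ob) (M : fam_pro X Y) (N : fam_pro Y Z) :
    fam_pro X Z :=
  @MkFamPro X Z (set_span_comp (fp_span M) (fp_span N))
    (class_spb _ _ (fp_spanP M) (fam_idxP Y) (fp_spanP N))
    (fun i l c => fp_pro (elt_fst c) ⊙ fp_pro (elt_snd c)).

Definition fam_vid (X Y : fam_ob) (M : fam_pro X Y) :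
  fam_cell M M (fam_idm X) (fam_idm Y).
Proof.
exists (@MkSetSpanMap _ _ _ _ (fp_span M) (fp_span M) (fam_idm X) (fam_idm Y)
  (fun a => a) (fun a => eq_refl) (fun a => eq_refl)) => i j a; destruct a as [a [] []].
exact: vid.
Defined.

Section Vcomp.
Context (X Y X' Y' X'' Y'' : fam_ob).
Context (M : fam_pro X Y) (N : fam_pro X' Y') (P : fam_pro X'' Y'').
Context (F : fam_arr X X') (G : fam_arr Y Y').
Context (F' : fam_arr X' X'') (G' : fam_arr Y' Y'').
Context (α : fam_cell M N F G) (β : fam_cell N P F' G').

Definition fam_vcomp_map :
  set_span_map (fp_span M) (fp_span P) (fam_comp F F') (fam_comp G G') :=
  @MkSetSpanMap _ _ _ _ (fp_span M) (fp_span P) (fam_comp F F') (fam_comp G G')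
    (fun a => fc_map β (fc_map α a))
    (fun a => eq_trans (ssm_l (fc_map β) (fc_map α a)) (f_equal F' (ssm_l (fc_map α) a)))
    (fun a => eq_trans (ssm_r (fc_map β) (fc_map α a)) (f_equal G' (ssm_r (fc_map α) a))).

Definition fam_vcomp : fam_cell M P (fam_comp F F') (fam_comp G G').
Proof.
exists fam_vcomp_map => i j a; destruct a as [a [] []].
exact: (fc_cell α (Elt erefl erefl) • fc_cell β (elt_map (fc_map α) (Elt erefl erefl))).
Defined.

End Vcomp.

Definition fam_ucell (X Y : fam_ob) (F : fam_arr X Y) :
  fam_cell (fam_pid X) (fam_pid Y) F F.
Proof.
exists (@MkSetSpanMap _ _ _ _ (set_span_id (fam_idx X)) (set_span_id (fam_idx Y)) F F
  F (fun i => eq_refl) (fun i => eq_refl)) => i j a; destruct a as [a [] []].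
exact: ucell.
Defined.

Section Hcomp.
Context (X Y Z X' Y' Z' : fam_ob).
Context (M : fam_pro X Y) (N : fam_pro Y Z) (M' : fam_pro X' Y') (N' : fam_pro Y' Z').
Context (F : fam_arr X X') (G : fam_arr Y Y') (H : fam_arr Z Z').
Context (α : fam_cell M M' F G) (β : fam_cell N N' G H).

Definition fam_hcomp_map :
  set_span_map (fp_span (fam_pcomp M N)) (fp_span (fam_pcomp M' N')) F H :=
  @MkSetSpanMap _ _ _ _ (fp_span (fam_pcomp M N)) (fp_span (fam_pcomp M' N')) F H
    (fun c => @MkSpb _ _ _ (@ss_r _ _ (fp_span M')) (@ss_l _ _ (fp_span N'))
       (fc_map α (spb_fst c)) (G (spb_mid c)) (fc_map β (spb_snd c))
       (eq_trans (ssm_r (fc_map α) _) (f_equal G (spb_eql c)))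
       (eq_trans (ssm_l (fc_map β) _) (f_equal G (spb_eqr c))))
    (fun c => ssm_l (fc_map α) (spb_fst c))
    (fun c => ssm_r (fc_map β) (spb_snd c)).

Definition fam_hcomp : fam_cell (fam_pcomp M N) (fam_pcomp M' N') F H :=
  @MkFamCell _ _ _ _ (fam_pcomp M N) (fam_pcomp M' N') F H fam_hcomp_map
    (fun i l c => fc_cell α (elt_fst c) ⊖ fc_cell β (elt_snd c)).

End Hcomp.

Section Assoc.
Context (X Y Z W : fam_ob) (M : fam_pro X Y) (N : fam_pro Y Z) (P : fam_pro Z W).
Let A := fp_span M.
Let B := fp_span N.
Let C := fp_span P.

Definition fam_assoc_map :
  set_span_map (set_span_comp (set_span_comp A B) C) (set_span_comp A (set_span_comp B C))
    (fam_idm X) (fam_idm W) :=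
  @MkSetSpanMap _ _ _ _ (set_span_comp (set_span_comp A B) C)
    (set_span_comp A (set_span_comp B C)) (fam_idm X) (fam_idm W)
    (fun c => @MkSpb _ _ _ (@ss_r _ _ A) (@ss_l _ _ (set_span_comp B C))
      (spb_fst (spb_fst c)) (spb_mid (spb_fst c))
      (MkSpb (spb_eql c : ss_r (spb_snd (spb_fst c)) = _) (spb_eqr c))
      (spb_eql (spb_fst c)) (spb_eqr (spb_fst c)))
    (fun c => eq_refl) (fun c => eq_refl).

Definition fam_assoc_inv_map :
  set_span_map (set_span_comp A (set_span_comp B C)) (set_span_comp (set_span_comp A B) C)
    (fam_idm X) (fam_idm W) :=
  @MkSetSpanMap _ _ _ _ (set_span_comp A (set_span_comp B C))
    (set_span_comp (set_span_comp A B) C) (fam_idm X) (fam_idm W)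
    (fun c => @MkSpb _ _ _ (@ss_r _ _ (set_span_comp A B)) (@ss_l _ _ C)
      (MkSpb (spb_eql c) (spb_eqr c : ss_l (spb_fst (spb_snd c)) = _))
      (spb_mid (spb_snd c)) (spb_snd (spb_snd c))
      (spb_eql (spb_snd c)) (spb_eqr (spb_snd c)))
    (fun c => eq_refl) (fun c => eq_refl).

Definition fam_assoc :
  fam_cell (fam_pcomp (fam_pcomp M N) P) (fam_pcomp M (fam_pcomp N P))
    (fam_idm X) (fam_idm W).
Proof. exists fam_assoc_map => i l c; destruct c as [c [] []]; exact: assoc. Defined.

Definition fam_assoc_inv :
  fam_cell (fam_pcomp M (fam_pcomp N P)) (fam_pcomp (fam_pcomp M N) P)
    (fam_idm X) (fam_idm W).
Proof. exists fam_assoc_inv_map => i l c; destruct c as [c [] []]; exact: assoc_inv. Defined.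

End Assoc.

Section Unitors.
Context (X Y : fam_ob) (M : fam_pro X Y).
Let A := fp_span M.
Let I := set_span_id (fam_idx X).
Let J := set_span_id (fam_idx Y).

Definition fam_lun_map : set_span_map (set_span_comp I A) A (fam_idm X) (fam_idm Y) :=
  @MkSetSpanMap _ _ _ _ (set_span_comp I A) A (fam_idm X) (fam_idm Y)
    (fun c => spb_snd c)
    (fun c => eq_trans (spb_eqr c) (eq_sym (spb_eql c))) (fun c => eq_refl).

Definition fam_lun_inv_map : set_span_map A (set_span_comp I A) (fam_idm X) (fam_idm Y) :=
  @MkSetSpanMap _ _ _ _ A (set_span_comp I A) (fam_idm X) (fam_idm Y)
    (fun a => @MkSpb _ _ _ (@ss_r _ _ I) (@ss_l _ _ A) (ss_l a) (ss_l a) a eq_refl eq_refl)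
    (fun c => eq_refl) (fun c => eq_refl).

Definition fam_run_map : set_span_map (set_span_comp A J) A (fam_idm X) (fam_idm Y) :=
  @MkSetSpanMap _ _ _ _ (set_span_comp A J) A (fam_idm X) (fam_idm Y)
    (fun c => spb_fst c) (fun c => eq_refl)
    (fun c => eq_trans (spb_eql c) (eq_sym (spb_eqr c))).

Definition fam_run_inv_map : set_span_map A (set_span_comp A J) (fam_idm X) (fam_idm Y) :=
  @MkSetSpanMap _ _ _ _ A (set_span_comp A J) (fam_idm X) (fam_idm Y)
    (fun a => @MkSpb _ _ _ (@ss_r _ _ A) (@ss_l _ _ J) a (ss_r a) (ss_r a) eq_refl eq_refl)
    (fun c => eq_refl) (fun c => eq_refl).

Definition fam_lun : fam_cell (fam_pcomp (fam_pid X) M) M (fam_idm X) (fam_idm Y).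
Proof.
exists fam_lun_map => i l c; destruct c as [[a j b ea eb] p q], p, q, ea; exact: lun.
Defined.

Definition fam_lun_inv : fam_cell M (fam_pcomp (fam_pid X) M) (fam_idm X) (fam_idm Y).
Proof. exists fam_lun_inv_map => i l a; destruct a as [a [] []]; exact: lun_inv. Defined.

Definition fam_run : fam_cell (fam_pcomp M (fam_pid Y)) M (fam_idm X) (fam_idm Y).
Proof.
exists fam_run_map => i l c; destruct c as [[a j b ea eb] p q], p, q, eb; exact: run.
Defined.

Definition fam_run_inv : fam_cell M (fam_pcomp M (fam_pid Y)) (fam_idm X) (fam_idm Y).
Proof. exists fam_run_inv_map => i l a; destruct a as [a [] []]; exact: run_inv. Defined.

End Unitors.

Definition fam_data : DblData :=
  @MkDblData fam_cat fam_pro fam_cell fam_vid fam_vcomp fam_pid fam_pcomp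
    fam_ucell fam_hcomp fam_assoc fam_assoc_inv
    fam_lun fam_lun_inv fam_run fam_run_inv.

Notation fam_sq c := (@Sq fam_data _ _ _ _ _ _ _ _ c).

Lemma elt_eq (I J : SET) (A : set_span I J) i j (a b : elt A i j) :
  elt_val a = elt_val b -> a = b.
Proof.
case: a b => [a p q] [b p' q'] /= e; subst b.
by rewrite (proof_irrelevance _ p p') (proof_irrelevance _ q q').
Qed.

Lemma fam_cell_ext (X Y X' Y' : fam_ob) (M : fam_pro X Y) (N : fam_pro X' Y')
    (F F' : fam_arr X X') (G G' : fam_arr Y Y')
    (φ : fam_cell M N F G) (ψ : fam_cell M N F' G') :
  F = F' -> G = G' -> (forall a, fc_map φ a = fc_map ψ a) ->
  (forall a, let e := @Elt _ _ (fp_span M) (ss_l a) (ss_r a) a erefl erefl in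
    fc_cell φ e ≡ fc_cell ψ e) -> fam_sq φ = fam_sq ψ.
Proof.
move=> eF eG; subst F' G'.
case: φ ψ => [[h hl hr] c] [[h' hl' hr'] c'] /= eh.
have {}eh : h = h' by exact: functional_extensionality.
subst h'; have el := proof_irrelevance _ hl hl'; have er := proof_irrelevance _ hr hr'.
subst hl' hr' => ec; f_equal; f_equal.
do 3 apply: functional_extensionality_dep => ?.
apply: Sq_inj; match goal with a : elt _ _ _ |- _ => destruct a as [a [] []] end.
exact: ec.
Qed.

Lemma fc_vid (X Y : fam_ob) (M : fam_pro X Y) i j (a : elt (fp_span M) i j) :
  fc_cell (fam_vid M) a ≡ vid (fp_pro a).
Proof. by destruct a as [a [] []]. Qed.

Lemma fc_vcomp (X Y X' Y' X'' Y'' : fam_ob)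
    (M : fam_pro X Y) (N : fam_pro X' Y') (P : fam_pro X'' Y'')
    (F : fam_arr X X') (G : fam_arr Y Y')
    (F' : fam_arr X' X'') (G' : fam_arr Y' Y'')
    (α : fam_cell M N F G) (β : fam_cell N P F' G') i j (a : elt (fp_span M) i j) :
  fc_cell (fam_vcomp α β) a ≡ fc_cell α a • fc_cell β (elt_map (fc_map α) a).
Proof. by destruct a as [a [] []]. Qed.

Lemma fc_ucelll (X Y : fam_ob) (F : fam_arr X Y) i j (a : elt (fp_span (fam_pid X)) i j) :
  fc_cell (fam_ucell F) a ≡ ucell (fa_arr F i).
Proof. by destruct a as [a [] []]. Qed.

Lemma fc_ucellr (X Y : fam_ob) (F : fam_arr X Y) i j (a : elt (fp_span (fam_pid X)) i j) :
  fc_cell (fam_ucell F) a ≡ ucell (fa_arr F j).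
Proof. by destruct a as [a [] []]. Qed.

Lemma fc_assoc (X Y Z W : fam_ob) (M : fam_pro X Y) (N : fam_pro Y Z) (P : fam_pro Z W)
    i l (c : elt (fp_span (fam_pcomp (fam_pcomp M N) P)) i l) :
  fc_cell (fam_assoc M N P) c ≡
  assoc (fp_pro (elt_fst (elt_fst c))) (fp_pro (elt_snd (elt_fst c))) (fp_pro (elt_snd c)).
Proof. by destruct c as [c [] []]. Qed.

Lemma fc_assoc_inv (X Y Z W : fam_ob) (M : fam_pro X Y) (N : fam_pro Y Z)
    (P : fam_pro Z W) i l (c : elt (fp_span (fam_pcomp M (fam_pcomp N P))) i l) :
  fc_cell (fam_assoc_inv M N P) c ≡
  assoc_inv (fp_pro (elt_fst c)) (fp_pro (elt_fst (elt_snd c)))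
    (fp_pro (elt_snd (elt_snd c))).
Proof. by destruct c as [c [] []]. Qed.

Lemma fc_lun (X Y : fam_ob) (M : fam_pro X Y) i l
    (c : elt (fp_span (fam_pcomp (fam_pid X) M)) i l) :
  fc_cell (fam_lun M) c ≡ lun (fp_pro (elt_snd c)).
Proof. by destruct c as [[a j b ea eb] p q], p, q, ea. Qed.

Lemma fc_lun_inv (X Y : fam_ob) (M : fam_pro X Y) i l (a : elt (fp_span M) i l) :
  fc_cell (fam_lun_inv M) a ≡ lun_inv (fp_pro a).
Proof. by destruct a as [a [] []]. Qed.

Lemma fc_run (X Y : fam_ob) (M : fam_pro X Y) i l
    (c : elt (fp_span (fam_pcomp M (fam_pid Y))) i l) :
  fc_cell (fam_run M) c ≡ run (fp_pro (elt_fst c)).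
Proof. by destruct c as [[a j b ea eb] p q], p, q, eb. Qed.

Lemma fc_run_inv (X Y : fam_ob) (M : fam_pro X Y) i l (a : elt (fp_span M) i l) :
  fc_cell (fam_run_inv M) a ≡ run_inv (fp_pro a).
Proof. by destruct a as [a [] []]. Qed.

Lemma spb_eq (A J B : SET) (r : A -> J) (l : B -> J) (c d : spb r l) :
  spb_fst c = spb_fst d -> spb_snd c = spb_snd d -> c = d.
Proof.
case: c d => [a j b ea eb] [a' j' b' ea' eb'] /= e1 e2; subst a' b'.
destruct ea; destruct ea'; by rewrite (proof_irrelevance _ eb eb').
Qed.

Definition elt_pair (I J L : SET) (A : set_span I J) (B : set_span J L) i j l
    (a : elt A i j) (b : elt B j l) : elt (set_span_comp A B) i l :=
  @Elt _ _ (set_span_comp A B) i l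
    (@MkSpb _ _ _ (@ss_r _ _ A) (@ss_l _ _ B) (elt_val a) j (elt_val b)
      (elt_r a) (elt_l b)) (elt_l a) (elt_r b).

Lemma assoc_elt (X Y Z W : fam_ob) (M : fam_pro X Y) (N : fam_pro Y Z)
    (P : fam_pro Z W) i j k l (a a' : elt (fp_span M) i j) (b b' : elt (fp_span N) j k)
    (c c' : elt (fp_span P) k l) :
  elt_val a = elt_val a' -> elt_val b = elt_val b' -> elt_val c = elt_val c' ->
  assoc (fp_pro a) (fp_pro b) (fp_pro c) ≡ assoc (fp_pro a') (fp_pro b') (fp_pro c').
Proof. by move=> ea eb ec; rewrite (elt_eq ea) (elt_eq eb) (elt_eq ec). Qed.

Lemma vid_elt (X Y : fam_ob) (M : fam_pro X Y) i j (a a' : elt (fp_span M) i j) :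
  elt_val a = elt_val a' -> vid (fp_pro a) ≡ vid (fp_pro a').
Proof. by move=> ea; rewrite (elt_eq ea). Qed.

Lemma lun_elt (X Y : fam_ob) (M : fam_pro X Y) i j (a a' : elt (fp_span M) i j) :
  elt_val a = elt_val a' -> lun (fp_pro a) ≡ lun (fp_pro a').
Proof. by move=> ea; rewrite (elt_eq ea). Qed.

Definition Fam : DblCat.
Proof.
exists fam_data.
- move=> X Y X' Y' M N F G α; apply: fam_cell_ext => //; try exact: (@comp_idl fam_cat).
  move=> a e; apply: etrans (fc_vcomp _ _ _) _.
  by apply: etrans (vcomp_congr (fc_vid _) (erefl _)) _; exact: vcomp_idl.
- move=> X Y X' Y' M N F G α; apply: fam_cell_ext => //; try exact: (@comp_idr fam_cat).
  move=> a e; apply: etrans (fc_vcomp _ _ _) _.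
  by apply: etrans (vcomp_congr (erefl _) (fc_vid _)) _; exact: vcomp_idr.
- move=> X0 Y0 X1 Y1 X2 Y2 X3 Y3 M0 M1 M2 M3 F0 F1 F2 G0 G1 G2 α β γ.
  apply: fam_cell_ext => //; try exact: (@comp_assoc fam_cat).
  move=> a e; transitivity (Sq (fc_cell α e • fc_cell β (elt_map (fc_map α) e) •
      fc_cell γ (elt_map (fc_map β) (elt_map (fc_map α) e)))); first by [].
  rewrite vcomp_assoc; apply: esym; apply: etrans (fc_vcomp _ _ _) _.
  exact: vcomp_congr (erefl _) (fc_vcomp _ _ _).
- move=> X; apply: Sq_inj; apply: fam_cell_ext => // a e /=.
  by rewrite ucell_id.
- move=> X Y Z F G; apply: Sq_inj; apply: fam_cell_ext => // a e /=.
  by rewrite ucell_comp.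
- move=> X Y Z M N; apply: Sq_inj; apply: fam_cell_ext => // [c|c e].
    exact: spb_eq.
  by apply: etrans (hcomp_congr (fc_vid _) (fc_vid _)) _; rewrite hcomp_id.
- move=> X Y Z X' Y' Z' X'' Y'' Z'' M N M' N' M'' N'' F G H F' G' H' α β α' β'.
  apply: Sq_inj; apply: fam_cell_ext => // [c|c e]; first exact: spb_eq.
  transitivity (Sq ((fc_cell α (elt_fst e) • fc_cell α' (elt_map (fc_map α) (elt_fst e)))
    ⊖ (fc_cell β (elt_snd e) • fc_cell β' (elt_map (fc_map β) (elt_snd e))))).
    exact: (hcomp_congr (fc_vcomp α α' (elt_fst e)) (fc_vcomp β β' (elt_snd e))).
  by rewrite hcomp_comp.
- move=> X Y Z W X' Y' Z' W' M N P M' N' P' F G H L α β γ.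
  apply: fam_cell_ext => [|||c e];
    [exact: etrans (@comp_idr fam_cat _ _ _) (esym (@comp_idl fam_cat _ _ _)) ..| |].
    by move=> c; apply: spb_eq => //; exact: spb_eq.
  transitivity (Sq (((fc_cell α (elt_fst (elt_fst e)) ⊖ fc_cell β (elt_snd (elt_fst e)))
      ⊖ fc_cell γ (elt_snd e)) • assoc _ _ _)).
    apply: etrans (fc_vcomp _ _ _) _; exact: vcomp_congr (erefl _) (fc_assoc _).
  rewrite assoc_nat; apply: esym; apply: etrans (fc_vcomp _ _ _) _.
  exact: vcomp_congr (fc_assoc e) (erefl _).
- move=> X Y X' Y' M N F G α; apply: fam_cell_ext => [|||[k j b ea eb]];
    [exact: etrans (@comp_idr fam_cat _ _ _) (esym (@comp_idl fam_cat _ _ _)) ..|by []|].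
  destruct ea => e.
  transitivity (Sq ((ucell (fa_arr F k) ⊖ fc_cell α (elt_snd e)) • lun _)).
    apply: etrans (fc_vcomp _ _ _) _; apply: vcomp_congr; last exact: fc_lun.
    exact: hcomp_congr (fc_ucellr _ _) (erefl _).
  rewrite lun_nat; apply: esym; apply: etrans (fc_vcomp _ _ _) _.
  exact: vcomp_congr (fc_lun e) (erefl _).
- move=> X Y X' Y' M N F G α; apply: fam_cell_ext => [|||[b j k ea eb]];
    [exact: etrans (@comp_idr fam_cat _ _ _) (esym (@comp_idl fam_cat _ _ _)) ..|by []|].
  destruct eb => e.
  transitivity (Sq ((fc_cell α (elt_fst e) ⊖ ucell (fa_arr G k)) • run _)).
    apply: etrans (fc_vcomp _ _ _) _; apply: vcomp_congr; last exact: fc_run.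
    exact: hcomp_congr (erefl _) (fc_ucelll _ _).
  rewrite run_nat; apply: esym; apply: etrans (fc_vcomp _ _ _) _.
  exact: vcomp_congr (fc_run e) (erefl _).
- move=> X Y Z W M N P; apply: fam_cell_ext => [|||c e]; try exact: (@comp_idl fam_cat).
    by move=> c; apply: spb_eq => //; exact: spb_eq.
  apply: etrans (fc_vcomp _ _ _) _; apply: etrans _ (esym (fc_vid _)).
  transitivity (Sq (assoc _ _ _ • assoc_inv (fp_pro (elt_fst (elt_fst e)))
    (fp_pro (elt_snd (elt_fst e))) (fp_pro (elt_snd e)))); last exact: assocK.
  exact: vcomp_congr (fc_assoc e) (fc_assoc_inv _).
- move=> X Y Z W M N P; apply: fam_cell_ext => [|||c e]; try exact: (@comp_idl fam_cat).
    by move=> c; apply: spb_eq => //; exact: spb_eq.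
  apply: etrans (fc_vcomp _ _ _) _; apply: etrans _ (esym (fc_vid _)).
  transitivity (Sq (assoc_inv _ _ _ • assoc (fp_pro (elt_fst e))
    (fp_pro (elt_fst (elt_snd e))) (fp_pro (elt_snd (elt_snd e))))); last exact: assocVK.
  exact: vcomp_congr (fc_assoc_inv e) (fc_assoc _).
- move=> X Y M; apply: fam_cell_ext => [|||[k j b ea eb]]; try exact: (@comp_idl fam_cat).
    case=> k j b ea eb; destruct ea; exact: spb_eq.
  destruct ea => e; apply: etrans (fc_vcomp _ _ _) _; apply: etrans _ (esym (fc_vid _)).
  transitivity (Sq (lun (fp_pro (elt_snd e)) • lun_inv _)); last exact: lunK.
  exact: vcomp_congr (fc_lun e) (fc_lun_inv _).
- move=> X Y M; apply: fam_cell_ext => [|||c e] //; try exact: (@comp_idl fam_cat).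
  apply: etrans (fc_vcomp _ _ _) _; apply: etrans _ (esym (fc_vid _)).
  transitivity (Sq (lun_inv (fp_pro e) • lun _)); last exact: lunVK.
  exact: vcomp_congr (fc_lun_inv e) (fc_lun _).
- move=> X Y M; apply: fam_cell_ext => [|||[b j k ea eb]]; try exact: (@comp_idl fam_cat).
    case=> b j k ea eb; destruct eb; exact: spb_eq.
  destruct eb => e; apply: etrans (fc_vcomp _ _ _) _; apply: etrans _ (esym (fc_vid _)).
  transitivity (Sq (run (fp_pro (elt_fst e)) • run_inv _)); last exact: runK.
  exact: vcomp_congr (fc_run e) (fc_run_inv _).
- move=> X Y M; apply: fam_cell_ext => [|||c e] //; try exact: (@comp_idl fam_cat).
  apply: etrans (fc_vcomp _ _ _) _; apply: etrans _ (esym (fc_vid _)).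
  transitivity (Sq (run_inv (fp_pro e) • run _)); last exact: runVK.
  exact: vcomp_congr (fc_run_inv e) (fc_run _).
- move=> X Y Z W V M N P Q.
  apply: fam_cell_ext => [|||c e]; [by rewrite !(@comp_idl fam_cat) ..| |].
    move=> c; apply: spb_eq; first reflexivity.
    apply: spb_eq; first reflexivity; apply: spb_eq; reflexivity.
  pose a := elt_fst (elt_fst (elt_fst e)).
  pose b := elt_snd (elt_fst (elt_fst e)).
  pose c' := elt_snd (elt_fst e); pose d := elt_snd e.
  transitivity (Sq (assoc (fp_pro a ⊙ fp_pro b) (fp_pro c') (fp_pro d) •
      assoc (fp_pro a) (fp_pro b) (fp_pro c' ⊙ fp_pro d))).
    apply: etrans (fc_vcomp _ _ _) _; exact: vcomp_congr (fc_assoc e) (fc_assoc _).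
  rewrite pentagon; apply: esym.
  pose φ := fam_hcomp (fam_assoc M N P) (fam_vid Q).
  have h1 : fc_cell φ e ≡
      assoc (fp_pro a) (fp_pro b) (fp_pro c') ⊖ vid (fp_pro d).
    exact: hcomp_congr (fc_assoc (elt_fst e)) (fc_vid (elt_snd e)).
  pose e1 := elt_map (fc_map φ) e.
  have h2 : fc_cell (fam_assoc M (fam_pcomp N P) Q) e1 ≡
      assoc (fp_pro a) (fp_pro b ⊙ fp_pro c') (fp_pro d).
    apply: etrans (fc_assoc e1) _.
    apply: (@assoc_elt _ _ _ _ M (fam_pcomp N P) Q _ _ _ _ _ a _ (elt_pair b c') _ d);
      [reflexivity | by apply: spb_eq | reflexivity].
  pose e2 := elt_map (fc_map (fam_vcomp φ (fam_assoc M (fam_pcomp N P) Q))) e.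
  have h3 : fc_cell (fam_hcomp (fam_vid M) (fam_assoc N P Q)) e2 ≡
      vid (fp_pro a) ⊖ assoc (fp_pro b) (fp_pro c') (fp_pro d).
    apply: hcomp_congr.
      apply: etrans (fc_vid (elt_fst e2)) _.
      exact: (@vid_elt _ _ M _ _ (elt_fst e2) a).
    apply: etrans (fc_assoc (elt_snd e2)) _.
    exact: (@assoc_elt _ _ _ _ N P Q _ _ _ _ _ b _ c' _ d).
  apply: etrans (fc_vcomp _ _ e) _; apply: vcomp_congr h3.
  apply: etrans (fc_vcomp _ _ e) _; exact: vcomp_congr h1 h2.
- move=> X Y Z M N.
  apply: fam_cell_ext => [|||[[a j b ea eb] k c ec ed]];
    [exact: (@comp_idl fam_cat) ..| |].
    case=> [[a j b ea eb] k c ec ed]; destruct eb, ec; exact: spb_eq.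
  destruct eb, ec => e.
  transitivity (Sq (assoc (fp_pro (elt_fst (elt_fst e))) (pid (Y b)) (fp_pro (elt_snd e))
      • (vid (fp_pro (elt_fst (elt_fst e))) ⊖ lun (fp_pro (elt_snd e))))).
    apply: etrans (fc_vcomp _ _ e) _; apply: vcomp_congr (fc_assoc e) _.
    apply: hcomp_congr; first exact: fc_vid.
    apply: etrans (fc_lun _) _; exact: lun_elt.
  rewrite triangle; apply: esym.
  exact: (hcomp_congr (fc_run (elt_fst e)) (fc_vid (elt_snd e))).
Defined.

End Fam.

Section Delta.
Context (K : SetClass) (D : DblCat).

Definition delta_pro (x y : D) (m : pro x y) :
    fam_pro (MkFamOb (class_unit K) (fun _ => x)) (MkFamOb (class_unit K) (fun _ => y)) :=
  @MkFamPro K D (MkFamOb (class_unit K) (fun _ => x)) (MkFamOb (class_unit K) (fun _ => y))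
    (set_span_id unit) (class_unit K) (fun _ _ _ => m).

Definition delta_fmul_map :
  set_span_map (set_span_id unit) (set_span_comp (set_span_id unit) (set_span_id unit))
    (fun i => i) (fun i => i) :=
  @MkSetSpanMap _ _ _ _ (set_span_id unit)
    (set_span_comp (set_span_id unit) (set_span_id unit)) (fun i => i) (fun i => i)
    (fun t => @MkSpb unit unit unit (fun i => i) (fun i => i) t t t eq_refl eq_refl)
    (fun _ => eq_refl) (fun _ => eq_refl).

Definition set_span_map_id (I J : SET) (A : set_span I J) :
    set_span_map A A (fun i => i) (fun j => j) :=
  @MkSetSpanMap _ _ _ _ A A (fun i => i) (fun j => j)
    (fun a => a) (fun _ => eq_refl) (fun _ => eq_refl).

Definition delta_data : ColaxData D (Fam K D).
Proof.
unshelve refine (@MkColaxData D (Fam K D)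
  (fun x => MkFamOb (class_unit K) (fun _ => x))
  (fun x y f => @MkFamArr K D (MkFamOb (class_unit K) (fun _ => x))
    (MkFamOb (class_unit K) (fun _ => y)) (fun i => i) (fun _ => f))
  delta_pro _ _ _).
- move=> x y x' y' m n f g α.
  by exists (set_span_map_id (set_span_id unit)) => i j a; exact: α.
- move=> x y z m n.
  by exists delta_fmul_map => i j a; exact: vid.
- move=> x.
  exists (set_span_map_id (set_span_id unit)) => i j a; destruct a as [a [] []].
  exact: vid.
Defined.

Definition Delta : ColaxFunctor D (Fam K D).
Proof.
exists delta_data => //.
- move=> x y m; apply: fam_cell_ext => // t e; exact: esym (fc_vid _).
- move=> x y x' y' x'' y'' m n p f g f' g' α β; exact: fam_cell_ext.
- move=> x y z x' y' z' m n m' n' f g h α β.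
  apply: fam_cell_ext => [|||t e];
    [by apply: fam_arr_ext => i; rewrite comp_idl comp_idr ..|by []|].
  apply: etrans (fc_vcomp _ _ e) _; apply: etrans (vcomp_idr (α ⊖ β)) _.
  apply: esym; apply: etrans (fc_vcomp _ _ e) _; exact: vcomp_idl.
- move=> x y f.
  apply: fam_cell_ext => [|||t e];
    [by apply: fam_arr_ext => i; rewrite comp_idl comp_idr ..|by []|].
  apply: etrans (fc_vcomp _ _ e) _; apply: etrans (vcomp_idr (ucell f)) _.
  apply: esym; apply: etrans (fc_vcomp _ _ e) _; exact: vcomp_idl.
- move=> x y z w m n p.
  apply: fam_cell_ext => [|||t e];
    try by apply: fam_arr_ext => i; rewrite !comp_idl.
    by move=> t; apply: spb_eq => //; apply: spb_eq.
  transitivity (Sq (vid ((m ⊙ n) ⊙ p) • (vid (m ⊙ n) ⊖ vid p) • assoc m n p)).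
    apply: etrans (fc_vcomp _ _ e) _; apply: vcomp_congr; last exact: fc_assoc.
    apply: etrans (fc_vcomp _ _ e) _; apply: vcomp_congr (erefl _) _.
    exact: hcomp_congr (erefl _) (fc_vid _).
  transitivity (Sq (assoc m n p • vid (m ⊙ (n ⊙ p)) • (vid m ⊖ vid (n ⊙ p)))).
    exact: (fmul_assoc (colax_id D)).
  apply: esym; apply: etrans (fc_vcomp _ _ e) _; apply: vcomp_congr.
    apply: etrans (fc_vcomp _ _ e) _; apply: vcomp_congr (erefl _) (erefl _).
  exact: hcomp_congr (fc_vid _) (erefl _).
- move=> x y m.
  apply: fam_cell_ext => [|||t e];
    [by apply: fam_arr_ext => i; rewrite !comp_idl ..|by case|].
  transitivity (Sq (vid (pid x ⊙ m) • (vid (pid x) ⊖ vid m) • lun m)).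
    apply: etrans (fc_vcomp _ _ e) _; apply: vcomp_congr; last exact: fc_lun.
    apply: etrans (fc_vcomp _ _ e) _; apply: vcomp_congr (erefl _) _.
    exact: hcomp_congr (erefl _) (fc_vid _).
  exact: (fmul_lun (colax_id D)).
- move=> x y m.
  apply: fam_cell_ext => [|||t e];
    [by apply: fam_arr_ext => i; rewrite !comp_idl ..|by case|].
  transitivity (Sq (vid (m ⊙ pid y) • (vid m ⊖ vid (pid y)) • run m)).
    apply: etrans (fc_vcomp _ _ e) _; apply: vcomp_congr; last exact: fc_run.
    apply: etrans (fc_vcomp _ _ e) _; apply: vcomp_congr (erefl _) _.
    exact: hcomp_congr (fc_vid _) (erefl _).
  exact: (fmul_run (colax_id D)).
Defined.

End Delta.

Record ColaxCoproducts (K : SetClass) (D : DblCat) := MkColaxCoproducts {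
  Sigma : ColaxFunctor (Fam K D) D;
  Sigma_adj : Adjunction Sigma (Delta K D) }.

Definition has_colax_K_coproducts (K : SetClass) (D : DblCat) : Prop :=
  inhabited (ColaxCoproducts K D).

(* Left adjoints being unique up to isomorphism, it does not matter which Sigma
   is chosen. *)
Definition has_strong_K_coproducts (K : SetClass) (D : DblCat) : Prop :=
  exists c : ColaxCoproducts K D, is_pseudo (Sigma c).

Definition has_colax_coproducts := has_colax_K_coproducts all_sets.
Definition has_strong_coproducts := has_strong_K_coproducts all_sets.
Definition has_colax_finite_coproducts := has_colax_K_coproducts finite_sets.
Definition has_strong_finite_coproducts := has_strong_K_coproducts finite_sets.

(* Main.v *)
From Corelib Require Import ssreflect ssrfun.
From Stdlib Require Import FunctionalExtensionality ProofIrrelevance ClassicalEpsilon.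
Require Import Defs.

(** Sigma is left adjoint to Delta when every family, of objects or of proarrows, has
a universal map to a single object or proarrow.  For objects this is a coproduct;
for a family [M] of proarrows over families [X] and [Y] it is a universal family of
cells into one proarrow from the coproduct of [X] to the coproduct of [Y], which is
[is_pro_coproduct].  If all families have these ([DblCoproducts]), every component
of Sigma is a copairing.  The comparison Sigma(M ⊙ N) -> Sigma M ⊙ Sigma N is
copaired from the horizontal composites of the coprojections, and the comparison
Sigma(id) -> id from the unit cells on the coprojections.  The coprojections form
the unit of the adjunction and the codiagonals its counit.  Each coherence law
compares two cells out of Sigma M, and after precomposition with a coprojection it
becomes the same law in [D].  This is [sigma_coproducts].

The source of a comparison cell has the universal property, so the cell is
invertible as soon as its target has it too, that is, when universal families of
cells are closed under external composition and external identities
([sigma_pseudo]).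

In spans, a family of cells is universal when the apexes form a coproduct
([span_pro_coproduct]), so coproducts in the base category give [DblCoproducts].
The apex of the identity on a coproduct is that coproduct, so external identities
are preserved.  For composites let [Y] be the middle family, with coproduct [cY], and let [R] be the
pullback over [cY] of the apexes of Sigma M and Sigma N.  Stability, applied
first to the apex of Sigma M and then to that of Sigma N, presents [R] as the
coproduct of the pieces m_a ×_cY n_b over all pairs of indices (a, b).  When a and
b meet at the same j, the coprojection of [Y j] being mono makes the piece equal
to m_a ×_(Y j) n_b, which is the apex of the composite; when they do not, the piece
maps to the pullback of two distinct coprojections, which is initial, and so the
piece is initial because initial objects are strict ([strict_initial]).  Dropping
the initial pieces leaves the family indexed by the composite span of sets
([composite_coproduct]). *)

Set Implicit Arguments.
Unset Strict Implicit.
Unset Printing Implicit Defensive.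

(** * Universal families of arrows and of cells *)

Lemma unique_ex_eq (T : Type) (Q : T -> Prop) (a b : T) :
  (exists! h, Q h) -> Q a -> Q b -> a = b.
Proof. by case=> h [_ u] qa qb; rewrite -(u a qa) (u b qb). Qed.

Section Copairing.
Context (S : Cat) (I : SET) (x : I -> S) (c : S) (inj : forall i, hom (x i) c).
Hypothesis injP : is_coproduct inj.

Definition copair (z : S) (k : forall i, hom (x i) z) : hom c z :=
  proj1_sig (constructive_definite_description _ (injP k)).

Lemma copairE (z : S) (k : forall i, hom (x i) z) i : inj i ;; copair k = k i.
Proof. exact: (proj2_sig (constructive_definite_description _ (injP k))). Qed.

Lemma copair_ext (z : S) (h k : hom c z) :
  (forall i, inj i ;; h = inj i ;; k) -> h = k.
Proof. by move=> e; exact: (unique_ex_eq (injP (fun i => inj i ;; k))). Qed.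

End Copairing.

Section ProCoproduct.
Context (K : SetClass) (D : DblCat) (X Y : fam_ob K D) (M : fam_pro X Y).
Context (c d : D) (ιX : forall i, hom (X i) c) (ιY : forall j, hom (Y j) d).

(** Together with [ιX] and [ιY], a universal cell from the family [M] to a singleton
family.  It is not a coproduct among all proarrows and cells: the boundary families
of that coproduct are indexed by the apex of the span of sets, those of [M] by its
two feet. *)
Definition is_pro_coproduct (m : pro c d)
    (ι : forall i j (e : elt (fp_span M) i j), cell (fp_pro e) m (ιX i) (ιY j)) : Prop :=
  forall (z w : D) (n : pro z w) (u : hom c z) (v : hom d w)
    (κ : forall i j (e : elt (fp_span M) i j), cell (fp_pro e) n (ιX i ;; u) (ιY j ;; v)),
    exists! α : cell m n u v, forall i j (e : elt (fp_span M) i j), ι i j e • α = κ i j e.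

Context (m : pro c d).
Context (ι : forall i j (e : elt (fp_span M) i j), cell (fp_pro e) m (ιX i) (ιY j)).
Hypothesis ιP : is_pro_coproduct ι.

(** The cells to be copaired usually have a boundary that equals a composite with
the cocone only propositionally, whence the separate [f] and [g]. *)
Lemma pro_copair_sig (z w : D) (n : pro z w) (u : hom c z) (v : hom d w) f g
    (κ : forall i j (e : elt (fp_span M) i j), cell (fp_pro e) n (f i) (g j)) :
  (forall i, ιX i ;; u = f i) -> (forall j, ιY j ;; v = g j) ->
  {α : cell m n u v | forall i j (e : elt (fp_span M) i j), ι e • α ≡ κ i j e}.
Proof.
move=> hf hg.
pose κ' i j (e : elt (fp_span M) i j) := cast_cell (esym (hf i)) (esym (hg j)) (κ i j e).
have [α hα] := constructive_definite_description _ (ιP κ').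
exists α => i j e; rewrite hα; exact: cast_cellE.
Qed.

Lemma pro_copair_ext (z w : D) (n : pro z w) u v u' v'
    (α : cell m n u v) (β : cell m n u' v') :
  u = u' -> v = v' ->
  (forall i j (e : elt (fp_span M) i j), ι e • α ≡ ι e • β) -> α ≡ β.
Proof.
move=> eu ev; subst u' v' => h; f_equal.
apply: (unique_ex_eq (ιP (fun i j e => ι e • β))) => // i j e.
exact: Sq_inj.
Qed.

End ProCoproduct.

(** Naturality squares compose vertically. *)
Lemma vcomp_paste (D : DblCat) (x0 y0 x1 y1 x2 y2 w0 v0 w1 v1 w2 v2 : D)
    (m0 : pro x0 y0) (m1 : pro x1 y1) (m2 : pro x2 y2)
    (n0 : pro w0 v0) (n1 : pro w1 v1) (n2 : pro w2 v2)
    f0 g0 f1 g1 f2 g2 h0 k0 h1 k1 a0 b0 a1 b1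
    (ι0 : cell m0 n0 f0 g0) (ι1 : cell m1 n1 f1 g1) (ι2 : cell m2 n2 f2 g2)
    (α : cell n0 n1 h0 k0) (β : cell n1 n2 h1 k1)
    (κ : cell m0 m1 a0 b0) (μ : cell m1 m2 a1 b1) :
  ι0 • α ≡ κ • ι1 -> ι1 • β ≡ μ • ι2 -> ι0 • (α • β) ≡ (κ • μ) • ι2.
Proof.
move=> e1 e2; apply: etrans (esym (vcomp_assoc _ _ _)) _.
apply: etrans (vcomp_congr e1 (erefl _)) _; apply: etrans (vcomp_assoc _ _ _) _.
apply: etrans (vcomp_congr (erefl _) e2) _; exact: esym (vcomp_assoc _ _ _).
Qed.

(** The comparison cells of a composite of colax functors are casts; these two
lemmas remove them. *)
Lemma vcomp_castl (E : DblCat) (x0 y0 x1 y1 x2 y2 : E) (m0 : pro x0 y0) (m1 : pro x1 y1)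
    (m2 : pro x2 y2) f g f' g' h k (ef : f = f') (eg : g = g')
    (α : cell m0 m1 f g) (β : cell m1 m2 h k) : cast_cell ef eg α • β ≡ α • β.
Proof. by destruct ef, eg. Qed.

Lemma vcomp_castr (E : DblCat) (x0 y0 x1 y1 x2 y2 : E) (m0 : pro x0 y0) (m1 : pro x1 y1)
    (m2 : pro x2 y2) f g h k h' k' (eh : h = h') (ek : k = k')
    (α : cell m0 m1 f g) (β : cell m1 m2 h k) : α • cast_cell eh ek β ≡ α • β.
Proof. by destruct eh, ek. Qed.

Record DblCoproducts (K : SetClass) (D : DblCat) := MkDblCoproducts {
  dc_ob : fam_ob K D -> D;
  dc_inj : forall (X : fam_ob K D) (i : fam_idx X), hom (X i) (dc_ob X);
  dc_injP : forall X : fam_ob K D, is_coproduct (@dc_inj X);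
  dc_pro : forall X Y : fam_ob K D, fam_pro X Y -> pro (dc_ob X) (dc_ob Y);
  dc_pinj : forall (X Y : fam_ob K D) (M : fam_pro X Y) i j (e : elt (fp_span M) i j),
    cell (fp_pro e) (dc_pro M) (@dc_inj X i) (@dc_inj Y j);
  dc_pinjP : forall (X Y : fam_ob K D) (M : fam_pro X Y), is_pro_coproduct (@dc_pinj _ _ M) }.
Arguments dc_inj {K D} d X i.
Arguments dc_injP {K D} d X.
Arguments dc_pro {K D} d {X Y} M.
Arguments dc_pinjP {K D} d {X Y} M.
Arguments dc_pinj {K D} d {X Y M i j} e.

(** * The colax functor of coproducts *)

Section ColaxSigma.
Context (K : SetClass) (D : DblCat) (C : DblCoproducts K D).
Notation "∐ X" := (dc_ob C X) (at level 10, X at level 9).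
Notation inj := (dc_inj C).
Notation pinj := (dc_pinj C).

(** The two sides of a coherence law reach the same index with different proofs of its
endpoints. *)
Lemma pinj_elt (X Y : fam_ob K D) (M : fam_pro X Y) i j (e e' : elt (fp_span M) i j) :
  elt_val e = elt_val e' -> pinj e ≡ pinj e'.
Proof. by move=> h; rewrite (elt_eq h). Qed.

Definition sigma_arr (X Y : fam_ob K D) (F : fam_arr X Y) : hom (∐ X) (∐ Y) :=
  copair (dc_injP C X) (fun i => fa_arr F i ;; inj Y (F i)).

Lemma sigma_arrE (X Y : fam_ob K D) (F : fam_arr X Y) i :
  inj X i ;; sigma_arr F = fa_arr F i ;; inj Y (F i).
Proof. exact: copairE. Qed.

Definition sigma_cell_sig (X Y X' Y' : fam_ob K D) (M : fam_pro X Y) (N : fam_pro X' Y')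
    (F : fam_arr X X') (G : fam_arr Y Y') (α : fam_cell M N F G) :=
  pro_copair_sig (dc_pinjP C M) (u := sigma_arr F) (v := sigma_arr G)
    (fun i j e => fc_cell α e • pinj (elt_map (fc_map α) e))
    (sigma_arrE F) (sigma_arrE G).

Definition sigma_cell (X Y X' Y' : fam_ob K D) (M : fam_pro X Y) (N : fam_pro X' Y')
    (F : fam_arr X X') (G : fam_arr Y Y') (α : fam_cell M N F G) :
    cell (dc_pro C M) (dc_pro C N) (sigma_arr F) (sigma_arr G) :=
  proj1_sig (sigma_cell_sig α).

Lemma sigma_cellE (X Y X' Y' : fam_ob K D) (M : fam_pro X Y) (N : fam_pro X' Y')
    (F : fam_arr X X') (G : fam_arr Y Y') (α : fam_cell M N F G)
    i j (e : elt (fp_span M) i j) :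
  pinj e • sigma_cell α ≡ fc_cell α e • pinj (elt_map (fc_map α) e).
Proof. exact: (proj2_sig (sigma_cell_sig α)). Qed.

Definition sigma_mul_sig (X Y Z : fam_ob K D) (M : fam_pro X Y) (N : fam_pro Y Z) :=
  pro_copair_sig (dc_pinjP C (fam_pcomp M N)) (u := idm _) (v := idm _)
    (fun i j e => pinj (elt_fst e) ⊖ pinj (elt_snd e))
    (fun i => comp_idr (inj X i)) (fun j => comp_idr (inj Z j)).

Definition sigma_mul (X Y Z : fam_ob K D) (M : fam_pro X Y) (N : fam_pro Y Z) :
    cell (dc_pro C (fam_pcomp M N)) (dc_pro C M ⊙ dc_pro C N) (idm _) (idm _) :=
  proj1_sig (sigma_mul_sig M N).

Lemma sigma_mulE (X Y Z : fam_ob K D) (M : fam_pro X Y) (N : fam_pro Y Z)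
    i j (e : elt (fp_span (fam_pcomp M N)) i j) :
  pinj e • sigma_mul M N ≡ pinj (elt_fst e) ⊖ pinj (elt_snd e).
Proof. exact: (proj2_sig (sigma_mul_sig M N)). Qed.

(** An element of the identity span of sets from [i] to [j] is an [i] equal to
[j], so the unit cell on [ι i] has to be transported along that equality. *)
Definition unit_leg (X : fam_ob K D) (c : D) (ι : forall i, hom (X i) c) i j
    (e : elt (fp_span (fam_pid X)) i j) : cell (fp_pro e) (pid c) (ι i) (ι j) :=
  match e with
  | @Elt _ _ _ _ _ k p q =>
    match p in _ = i', q in _ = j'
      return cell (@fp_pro _ _ _ _ (fam_pid X) i' j' (Elt p q)) (pid c) (ι i') (ι j') with
    | eq_refl, eq_refl => ucell (ι k)
    end
  end.

Definition sigma_unit_sig (X : fam_ob K D) :=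
  pro_copair_sig (dc_pinjP C (fam_pid X)) (u := idm _) (v := idm _)
    (unit_leg (inj X))
    (fun i => comp_idr (inj X i)) (fun j => comp_idr (inj X j)).

Definition sigma_unit (X : fam_ob K D) :
    cell (dc_pro C (fam_pid X)) (pid (∐ X)) (idm _) (idm _) :=
  proj1_sig (sigma_unit_sig X).

Lemma sigma_unitE (X : fam_ob K D) i j (e : elt (fp_span (fam_pid X)) i j) :
  pinj e • sigma_unit X ≡ unit_leg (inj X) e.
Proof. exact: (proj2_sig (sigma_unit_sig X)). Qed.

Lemma unit_legl (X : fam_ob K D) i j (e : elt (fp_span (fam_pid X)) i j) :
  unit_leg (inj X) e ≡ ucell (inj X i).
Proof. by destruct e as [a [] []]. Qed.

Lemma unit_legr (X : fam_ob K D) i j (e : elt (fp_span (fam_pid X)) i j) :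
  unit_leg (inj X) e ≡ ucell (inj X j).
Proof. by destruct e as [a [] []]. Qed.

Definition sigma_data : ColaxData (Fam K D) D :=
  @MkColaxData (Fam K D) D (dc_ob C) sigma_arr (fun X Y M => dc_pro C M)
    sigma_cell sigma_mul sigma_unit.

Lemma sigma_arr_id (X : fam_ob K D) : sigma_arr (fam_idm X) = idm (∐ X).
Proof.
by apply: (copair_ext (dc_injP C X)) => i; rewrite sigma_arrE comp_idl comp_idr.
Qed.

Lemma sigma_arr_comp (X Y Z : fam_ob K D) (F : fam_arr X Y) (G : fam_arr Y Z) :
  sigma_arr (fam_comp F G) = sigma_arr F ;; sigma_arr G.
Proof.
apply: (copair_ext (dc_injP C X)) => i.
by rewrite -comp_assoc !sigma_arrE !comp_assoc sigma_arrE.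
Qed.

Lemma sigma_cell_id (X Y : fam_ob K D) (M : fam_pro X Y) :
  sigma_cell (fam_vid M) ≡ vid (dc_pro C M).
Proof.
apply: (pro_copair_ext (dc_pinjP C M)); try exact: sigma_arr_id.
move=> i j e; apply: etrans (sigma_cellE _ e) _.
transitivity (Sq (vid (fp_pro e) • pinj e)).
  by apply: vcomp_congr; [exact: fc_vid | exact: pinj_elt].
exact: etrans (vcomp_idl _) (esym (vcomp_idr _)).
Qed.

Lemma sigma_cell_comp (X Y X' Y' X'' Y'' : fam_ob K D)
    (M : fam_pro X Y) (N : fam_pro X' Y') (P : fam_pro X'' Y'')
    (F : fam_arr X X') (G : fam_arr Y Y') (F' : fam_arr X' X'') (G' : fam_arr Y' Y'')
    (α : fam_cell M N F G) (β : fam_cell N P F' G') :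
  sigma_cell (fam_vcomp α β) ≡ sigma_cell α • sigma_cell β.
Proof.
apply: (pro_copair_ext (dc_pinjP C M)); try exact: sigma_arr_comp.
move=> i j e; apply: etrans (sigma_cellE _ e) _.
apply: etrans _ (esym (vcomp_paste (sigma_cellE α e) (sigma_cellE β _))).
by apply: vcomp_congr; [exact: fc_vcomp | exact: pinj_elt].
Qed.

Lemma sigma_mul_nat (X Y Z X' Y' Z' : fam_ob K D) (M : fam_pro X Y) (N : fam_pro Y Z)
    (M' : fam_pro X' Y') (N' : fam_pro Y' Z')
    (F : fam_arr X X') (G : fam_arr Y Y') (H : fam_arr Z Z')
    (α : fam_cell M M' F G) (β : fam_cell N N' G H) :
  sigma_cell (fam_hcomp α β) • sigma_mul M' N' ≡
  sigma_mul M N • (sigma_cell α ⊖ sigma_cell β).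
Proof.
apply: (pro_copair_ext (dc_pinjP C (fam_pcomp M N)));
  rewrite ?comp_idl ?comp_idr // => i j e.
apply: etrans (esym (vcomp_assoc _ _ _)) _.
apply: etrans (vcomp_congr (sigma_cellE _ e) (erefl _)) _.
apply: etrans (vcomp_assoc _ _ _) _.
apply: etrans (vcomp_congr (erefl _) (sigma_mulE _)) _; apply: esym.
apply: etrans (esym (vcomp_assoc _ _ _)) _.
apply: etrans (vcomp_congr (sigma_mulE e) (erefl _)) _.
rewrite -hcomp_comp.
apply: etrans (hcomp_congr (sigma_cellE α (elt_fst e)) (sigma_cellE β (elt_snd e))) _.
rewrite hcomp_comp; apply: vcomp_congr; first by [].
by apply: hcomp_congr; exact: pinj_elt.
Qed.

Lemma sigma_unit_nat (X Y : fam_ob K D) (F : fam_arr X Y) :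
  sigma_cell (fam_ucell F) • sigma_unit Y ≡ sigma_unit X • ucell (sigma_arr F).
Proof.
apply: (pro_copair_ext (dc_pinjP C (fam_pid X)));
  rewrite ?comp_idl ?comp_idr // => i j e.
apply: etrans (esym (vcomp_assoc _ _ _)) _.
apply: etrans (vcomp_congr (sigma_cellE _ e) (erefl _)) _.
apply: etrans (vcomp_assoc _ _ _) _.
apply: etrans (vcomp_congr (fc_ucelll _ _) (etrans (sigma_unitE _) (unit_legl _))) _.
rewrite -ucell_comp; apply: esym.
apply: etrans (esym (vcomp_assoc _ _ _)) _.
apply: etrans (vcomp_congr (etrans (sigma_unitE e) (unit_legl _)) (erefl _)) _.
by rewrite -ucell_comp sigma_arrE.
Qed.

Lemma sigma_mulE_hcomp (X Y Z : fam_ob K D) (M : fam_pro X Y) (N : fam_pro Y Z)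
    i l (e : elt (fp_span (fam_pcomp M N)) i l)
    (x y z : D) (m : pro x y) (n : pro y z) f g h
    (α : cell (dc_pro C M) m f g) (β : cell (dc_pro C N) n g h) :
  pinj e • (sigma_mul M N • (α ⊖ β)) ≡ (pinj (elt_fst e) • α) ⊖ (pinj (elt_snd e) • β).
Proof.
apply: etrans (esym (vcomp_assoc _ _ _)) _.
by apply: etrans (vcomp_congr (sigma_mulE e) (erefl _)) _; rewrite hcomp_comp.
Qed.

Lemma sigma_mul_assoc (X Y Z W : fam_ob K D) (M : fam_pro X Y) (N : fam_pro Y Z)
    (Q : fam_pro Z W) :
  sigma_mul (fam_pcomp M N) Q • (sigma_mul M N ⊖ vid (dc_pro C Q)) •
    assoc (dc_pro C M) (dc_pro C N) (dc_pro C Q) ≡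
  sigma_cell (fam_assoc M N Q) • sigma_mul M (fam_pcomp N Q) •
    (vid (dc_pro C M) ⊖ sigma_mul N Q).
Proof.
apply: (pro_copair_ext (dc_pinjP C (fam_pcomp (fam_pcomp M N) Q)));
  rewrite ?sigma_arr_id ?comp_idl ?comp_idr // => i l e.
transitivity (Sq (assoc _ _ _ •
  (pinj (elt_fst (elt_fst e)) ⊖ (pinj (elt_snd (elt_fst e)) ⊖ pinj (elt_snd e))))).
  rewrite -assoc_nat.
  apply: etrans (esym (vcomp_assoc _ _ _)) _; apply: vcomp_congr => //.
  apply: etrans (sigma_mulE_hcomp _ _ _) _.
  apply: hcomp_congr; [exact: sigma_mulE | exact: vcomp_idr].
apply: esym; apply: etrans (vcomp_congr (erefl _) (vcomp_assoc _ _ _)) _.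
apply: etrans (esym (vcomp_assoc _ _ _)) _.
apply: etrans (vcomp_congr (sigma_cellE _ e) (erefl _)) _.
apply: etrans (vcomp_assoc _ _ _) _; apply: vcomp_congr; first exact: fc_assoc.
apply: etrans (sigma_mulE_hcomp _ _ _) _.
apply: hcomp_congr.
  by apply: etrans (vcomp_idr _) _; exact: pinj_elt.
apply: etrans (sigma_mulE _) _.
by apply: hcomp_congr; exact: pinj_elt.
Qed.

Lemma sigma_mul_lun (X Y : fam_ob K D) (M : fam_pro X Y) :
  sigma_mul (fam_pid X) M • (sigma_unit X ⊖ vid (dc_pro C M)) • lun (dc_pro C M) ≡
  sigma_cell (fam_lun M).
Proof.
apply: (pro_copair_ext (dc_pinjP C (fam_pcomp (fam_pid X) M)));
  rewrite ?sigma_arr_id ?comp_idl ?comp_idr // => i l e.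
apply: etrans (esym (vcomp_assoc _ _ _)) _.
transitivity (Sq ((ucell (inj X (elt_mid e)) ⊖ pinj (elt_snd e)) • lun (dc_pro C M))).
  apply: vcomp_congr => //; apply: etrans (sigma_mulE_hcomp _ _ _) _.
  apply: hcomp_congr; last exact: vcomp_idr.
  exact: etrans (sigma_unitE _) (unit_legr _).
rewrite lun_nat; apply: esym; apply: etrans (sigma_cellE _ e) _.
destruct e as [[a j b ea eb] p q], p, q, ea.
by apply: vcomp_congr; [exact: fc_lun | exact: pinj_elt].
Qed.

Lemma sigma_mul_run (X Y : fam_ob K D) (M : fam_pro X Y) :
  sigma_mul M (fam_pid Y) • (vid (dc_pro C M) ⊖ sigma_unit Y) • run (dc_pro C M) ≡
  sigma_cell (fam_run M).
Proof.
apply: (pro_copair_ext (dc_pinjP C (fam_pcomp M (fam_pid Y))));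
  rewrite ?sigma_arr_id ?comp_idl ?comp_idr // => i l e.
apply: etrans (esym (vcomp_assoc _ _ _)) _.
transitivity (Sq ((pinj (elt_fst e) ⊖ ucell (inj Y (elt_mid e))) • run (dc_pro C M))).
  apply: vcomp_congr => //; apply: etrans (sigma_mulE_hcomp _ _ _) _.
  apply: hcomp_congr; first exact: vcomp_idr.
  exact: etrans (sigma_unitE _) (unit_legl _).
rewrite run_nat; apply: esym; apply: etrans (sigma_cellE _ e) _.
destruct e as [[a j b ea eb] p q], p, q, eb.
by apply: vcomp_congr; [exact: fc_run | exact: pinj_elt].
Qed.

Definition sigma_functor : ColaxFunctor (Fam K D) D :=
  @MkColaxFunctor (Fam K D) D sigma_data
    sigma_arr_id sigma_arr_comp sigma_cell_id sigma_cell_comp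
    sigma_mul_nat sigma_unit_nat sigma_mul_assoc sigma_mul_lun sigma_mul_run.

End ColaxSigma.

(** * The adjunction between coproducts and singleton families *)

Section SigmaAdjoint.
Context (K : SetClass) (D : DblCat) (C : DblCoproducts K D).
Notation Σ := (sigma_functor C).
Notation Δ := (Delta K D).

Definition coproj (X : fam_ob K D) : fam_arr X (Δ (Σ X)) :=
  @MkFamArr K D X (Δ (Σ X)) (fun _ => tt) (dc_inj C X).

Definition coproj_cell (X Y : fam_ob K D) (M : fam_pro X Y) :
    fam_cell M (fpro Δ (fpro Σ M)) (coproj X) (coproj Y) :=
  @MkFamCell K D X Y (Δ (Σ X)) (Δ (Σ Y)) M (fpro Δ (fpro Σ M)) (coproj X) (coproj Y)
    (@MkSetSpanMap _ _ _ _ (fp_span M) (set_span_id unit) _ _ (fun _ => tt)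
      (fun _ => erefl) (fun _ => erefl))
    (fun i j e => dc_pinj C e).

Lemma coproj_nat (X Y : fam_ob K D) (F : fam_arr X Y) :
  fam_comp F (coproj Y) = fam_comp (coproj X) (farr Δ (farr Σ F)).
Proof. by apply: fam_arr_ext => i; rewrite /= sigma_arrE. Qed.

Lemma coproj_cell_nat (X Y X' Y' : fam_ob K D) (M : fam_pro X Y) (N : fam_pro X' Y')
    (F : fam_arr X X') (G : fam_arr Y Y') (α : fam_cell M N F G) :
  @Sq (Fam K D) _ _ _ _ _ _ _ _ (fam_vcomp α (coproj_cell N)) =
  @Sq (Fam K D) _ _ _ _ _ _ _ _ (fam_vcomp (coproj_cell M) (fcell Δ (fcell Σ α))).
Proof.
apply: fam_cell_ext => [|||a e]; [exact: coproj_nat..|by []|].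
apply: etrans (fc_vcomp α _ e) _.
by apply: esym; apply: etrans (fc_vcomp _ _ e) _; exact: sigma_cellE.
Qed.

Lemma coproj_cell_mul (X Y Z : fam_ob K D) (M : fam_pro X Y) (N : fam_pro Y Z) :
  @Sq (Fam K D) _ _ _ _ _ _ _ _
    (fam_vcomp (fam_vid (fam_pcomp M N)) (fam_hcomp (coproj_cell M) (coproj_cell N))) =
  @Sq (Fam K D) _ _ _ _ _ _ _ _
    (fam_vcomp (coproj_cell (fam_pcomp M N))
      (fam_vcomp (fcell Δ (fmul Σ M N)) (fmul Δ (fpro Σ M) (fpro Σ N)))).
Proof.
apply: fam_cell_ext => [|||a e].
  by apply: fam_arr_ext => i /=; rewrite !comp_idr comp_idl.
  by apply: fam_arr_ext => i /=; rewrite !comp_idr comp_idl.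
  by move=> a; apply: (@spb_eq unit unit unit).
apply: etrans (fc_vcomp _ _ e) _.
apply: etrans (vcomp_congr (fc_vid e) (erefl _)) _; apply: etrans (vcomp_idl _) _.
apply: esym; apply: etrans (fc_vcomp _ _ e) _.
apply: etrans (vcomp_congr (erefl _) (fc_vcomp _ _ _)) _.
apply: etrans (esym (vcomp_assoc _ _ _)) _; apply: etrans (vcomp_idr _) _.
exact: (sigma_mulE C e).
Qed.

Lemma coproj_cell_unit (X : fam_ob K D) :
  @Sq (Fam K D) _ _ _ _ _ _ _ _
    (fam_vcomp (fam_vid (fam_pid X)) (fam_ucell (coproj X))) =
  @Sq (Fam K D) _ _ _ _ _ _ _ _
    (fam_vcomp (coproj_cell (fam_pid X))
      (fam_vcomp (fcell Δ (funit Σ X)) (funit Δ (Σ X)))).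
Proof.
apply: fam_cell_ext => [|||a e].
  by apply: fam_arr_ext => i /=; rewrite !comp_idr comp_idl.
  by apply: fam_arr_ext => i /=; rewrite !comp_idr comp_idl.
  by [].
apply: etrans (fc_vcomp _ _ e) _.
apply: etrans (vcomp_congr (fc_vid e) (erefl _)) _; apply: etrans (vcomp_idl _) _.
apply: esym; apply: etrans (fc_vcomp _ _ e) _.
apply: etrans (vcomp_congr (erefl _) (fc_vcomp _ _ _)) _.
apply: etrans (esym (vcomp_assoc _ _ _)) _; apply: etrans (vcomp_idr _) _.
exact: (sigma_unitE C e).
Qed.

Definition sigma_adj_unit : NatTrans (colax_id (Fam K D)) (colax_comp Σ Δ).
Proof.
unshelve refine (@MkNatTrans (Fam K D) (Fam K D) (colax_id (Fam K D)) (colax_comp Σ Δ)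
  coproj coproj_cell _ _ _ _).
- exact: coproj_nat.
- exact: coproj_cell_nat.
- move=> X Y Z M N.
  simple refine (@etrans _ _ _ _ _ (esym (vcomp_castr _ _ _ _))).
  exact: (coproj_cell_mul M N).
- move=> X; simple refine (@etrans _ _ _ _ _ (esym (vcomp_castr _ _ _ _))).
  exact: (coproj_cell_unit X).
Defined.


Definition codiag (x : D) : hom (Σ (Δ x)) x :=
  copair (dc_injP C (fob Δ x)) (fun _ => idm x).

Lemma codiagE (x : D) i : dc_inj C (fob Δ x) i ;; codiag x = idm x.
Proof. exact: copairE. Qed.

Arguments codiagE x i : clear implicits.

Definition codiag_cell_sig (x y : D) (m : pro x y) :=
  pro_copair_sig (dc_pinjP C (delta_pro K m)) (u := codiag x) (v := codiag y)
    (fun _ _ _ => vid m) (codiagE x) (codiagE y).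

Definition codiag_cell (x y : D) (m : pro x y) :
    cell (fpro Σ (fpro Δ m)) m (codiag x) (codiag y) :=
  proj1_sig (codiag_cell_sig m).

Lemma codiag_cellE (x y : D) (m : pro x y) i j (e : elt (fp_span (delta_pro K m)) i j) :
  dc_pinj C e • codiag_cell m ≡ vid m.
Proof. exact: (proj2_sig (codiag_cell_sig m)). Qed.

Lemma codiag_nat (x y : D) (f : hom x y) :
  sigma_arr C (farr Δ f) ;; codiag y = codiag x ;; f.
Proof.
apply: (copair_ext (dc_injP C (fob Δ x))) => i.
by rewrite -!comp_assoc sigma_arrE comp_assoc !codiagE comp_idl comp_idr.
Qed.

Lemma codiag_cell_nat (x y x' y' : D) (m : pro x y) (n : pro x' y')
    (f : hom x x') (g : hom y y') (α : cell m n f g) :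
  sigma_cell C (fcell Δ α) • codiag_cell n ≡ codiag_cell m • α.
Proof.
apply: (pro_copair_ext (dc_pinjP C (delta_pro K m))); try exact: codiag_nat.
move=> i j e; apply: etrans (esym (vcomp_assoc _ _ _)) _.
apply: etrans (vcomp_congr (sigma_cellE C (fcell Δ α) e) (erefl _)) _.
apply: etrans (vcomp_assoc _ _ _) _.
apply: etrans (vcomp_congr (erefl _) (codiag_cellE _)) _.
apply: etrans (vcomp_idr _) _; apply: esym.
apply: etrans (esym (vcomp_assoc _ _ _)) _.
apply: etrans (vcomp_congr (codiag_cellE e) (erefl _)) _; exact: vcomp_idl.
Qed.

Lemma codiag_cell_mul (x y z : D) (m : pro x y) (n : pro y z) :
  (sigma_cell C (fmul Δ m n) • sigma_mul C (delta_pro K m) (delta_pro K n)) •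
    (codiag_cell m ⊖ codiag_cell n) ≡ codiag_cell (m ⊙ n) • vid (m ⊙ n).
Proof.
apply: (pro_copair_ext (dc_pinjP C (delta_pro K (m ⊙ n)))).
  by rewrite (sigma_arr_id C (fob Δ x)) !comp_idl comp_idr.
  by rewrite (sigma_arr_id C (fob Δ z)) !comp_idl comp_idr.
move=> i l e.
apply: etrans _ (esym (vcomp_congr (erefl (Sq (dc_pinj C e))) (vcomp_idr _))).
apply: etrans _ (esym (codiag_cellE e)).
apply: etrans (vcomp_congr (erefl _) (vcomp_assoc _ _ _)) _.
apply: etrans (esym (vcomp_assoc _ _ _)) _.
apply: etrans (vcomp_congr (sigma_cellE C (fmul Δ m n) e) (erefl _)) _.
apply: etrans (vcomp_assoc _ _ _) _; apply: etrans (vcomp_idl _) _.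
pose e2 : elt (fp_span (fam_pcomp (delta_pro K m) (delta_pro K n))) i l :=
  elt_map (fc_map (fmul Δ m n)) e.
apply: etrans (sigma_mulE_hcomp e2 (codiag_cell m) (codiag_cell n)) _.
by apply: etrans (hcomp_congr (codiag_cellE _) (codiag_cellE _)) _; rewrite hcomp_id.
Qed.

Lemma codiag_cell_unit (x : D) :
  (sigma_cell C (funit Δ x) • sigma_unit C (fob Δ x)) • ucell (codiag x) ≡
  codiag_cell (pid x) • vid (pid x).
Proof.
apply: (pro_copair_ext (dc_pinjP C (delta_pro K (pid x)))).
  by rewrite (sigma_arr_id C (fob Δ x)) !comp_idl comp_idr.
  by rewrite (sigma_arr_id C (fob Δ x)) !comp_idl comp_idr.
move=> i l e.
apply: etrans _ (esym (vcomp_congr (erefl (Sq (dc_pinj C e))) (vcomp_idr _))).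
apply: etrans _ (esym (codiag_cellE e)).
apply: etrans (vcomp_congr (erefl _) (vcomp_assoc _ _ _)) _.
apply: etrans (esym (vcomp_assoc _ _ _)) _.
apply: etrans (vcomp_congr (sigma_cellE C (funit Δ x) e) (erefl _)) _.
destruct e as [a [] []].
apply: etrans (vcomp_assoc _ _ _) _; apply: etrans (vcomp_idl _) _.
apply: etrans (esym (vcomp_assoc _ _ _)) _.
pose e2 : elt (fp_span (fam_pid (fob Δ x))) a a := Elt erefl erefl.
transitivity (Sq (unit_leg (dc_inj C (fob Δ x)) e2 • ucell (codiag x))).
  by apply: vcomp_congr => //; exact: (sigma_unitE C e2).
by rewrite -ucell_comp codiagE ucell_id.
Qed.

Definition sigma_adj_counit : NatTrans (colax_comp Δ Σ) (colax_id D).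
Proof.
unshelve refine (@MkNatTrans D D (colax_comp Δ Σ) (colax_id D)
  codiag codiag_cell _ _ _ _).
- exact: codiag_nat.
- exact: codiag_cell_nat.
- move=> x y z m n; simple refine (@etrans _ _ _ _ (vcomp_castl _ _ _ _) _).
  exact: (codiag_cell_mul m n).
- move=> x; simple refine (@etrans _ _ _ _ (vcomp_castl _ _ _ _) _).
  exact: (codiag_cell_unit x).
Defined.

Lemma fam_arr_delta_ext (X : fam_ob K D) (y : D) (F G : fam_arr X (fob Δ y)) :
  (forall i, fa_arr F i = fa_arr G i :> hom (X i) y) -> F = G.
Proof.
case: F G => [f0 f] [g0 g] /= h.
have e : f0 = g0.
  by apply: functional_extensionality => i; case: (f0 i); case: (g0 i).
by subst g0; exact: fam_arr_ext.
Qed.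

Lemma sigma_triangleL (X : fam_ob K D) :
  sigma_arr C (coproj X) ;; codiag (Σ X) = idm (Σ X).
Proof.
apply: (copair_ext (dc_injP C X)) => i.
by rewrite -comp_assoc sigma_arrE comp_assoc codiagE.
Qed.

Lemma sigma_triangleL_pro (X Y : fam_ob K D) (M : fam_pro X Y) :
  sigma_cell C (coproj_cell M) • codiag_cell (dc_pro C M) ≡ vid (dc_pro C M).
Proof.
apply: (pro_copair_ext (dc_pinjP C M)); [exact: sigma_triangleL .. | move=> i j e].
apply: etrans (esym (vcomp_assoc _ _ _)) _.
apply: etrans (vcomp_congr (sigma_cellE C (coproj_cell M) e) (erefl _)) _.
apply: etrans (vcomp_assoc _ _ _) _; apply: vcomp_congr (erefl _) _.
exact: codiag_cellE.
Qed.

Lemma sigma_triangleR (y : D) :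
  fam_comp (coproj (fob Δ y)) (farr Δ (codiag y)) = fam_idm (fob Δ y).
Proof. by apply: fam_arr_delta_ext => i; exact: codiagE. Qed.

Lemma sigma_triangleR_pro (x y : D) (m : pro x y) :
  @Sq (Fam K D) _ _ _ _ _ _ _ _
    (fam_vcomp (coproj_cell (delta_pro K m)) (fcell Δ (codiag_cell m))) =
  @Sq (Fam K D) _ _ _ _ _ _ _ _ (fam_vid (delta_pro K m)).
Proof.
apply: fam_cell_ext => [|||a e]; [exact: sigma_triangleR .. | by case |].
apply: etrans (fc_vcomp _ _ e) _; apply: etrans _ (esym (fc_vid e)).
exact: (codiag_cellE e).
Qed.

Definition sigma_adjunction : Adjunction Σ Δ.
Proof.
unshelve refine (@MkAdjunction _ _ Σ Δ (sigma_adj_unit) (sigma_adj_counit) _ _ _ _).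
- exact: sigma_triangleL.
- exact: sigma_triangleL_pro.
- exact: sigma_triangleR.
- exact: sigma_triangleR_pro.
Defined.

Definition sigma_coproducts : ColaxCoproducts K D := MkColaxCoproducts sigma_adjunction.

(** * Strong coproducts *)

Lemma pro_coproduct_invertible (X Y : fam_ob K D) (M : fam_pro X Y) (m : pro (Σ X) (Σ Y))
    (ι : forall i j (e : elt (fp_span M) i j), cell (fp_pro e) m (dc_inj C X i) (dc_inj C Y j))
    (α : cell (dc_pro C M) m (idm _) (idm _)) :
  is_pro_coproduct ι -> (forall i j (e : elt (fp_span M) i j), dc_pinj C e • α ≡ ι i j e) ->
  cell_invertible α.
Proof.
move=> ιP αE.
have [β βE] := pro_copair_sig ιP (fun i j e => dc_pinj C e)
  (fun i => comp_idr (dc_inj C X i)) (fun j => comp_idr (dc_inj C Y j)).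
exists β; split.
  apply: (pro_copair_ext (dc_pinjP C M)); rewrite ?comp_idl // => i j e.
  apply: etrans (esym (vcomp_assoc _ _ _)) _.
  apply: etrans (vcomp_congr (αE i j e) (erefl _)) _.
  exact: etrans (βE i j e) (esym (vcomp_idr _)).
apply: (pro_copair_ext ιP); rewrite ?comp_idl // => i j e.
apply: etrans (esym (vcomp_assoc _ _ _)) _.
apply: etrans (vcomp_congr (βE i j e) (erefl _)) _.
exact: etrans (αE i j e) (esym (vcomp_idr _)).
Qed.

Lemma sigma_pseudo :
  (forall (X Y Z : fam_ob K D) (M : fam_pro X Y) (N : fam_pro Y Z),
    @is_pro_coproduct K D X Z (fam_pcomp M N) _ _ (dc_inj C X) (dc_inj C Z)
      (dc_pro C M ⊙ dc_pro C N)
      (fun i l e => dc_pinj C (elt_fst e) ⊖ dc_pinj C (elt_snd e))) ->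
  (forall X : fam_ob K D, @is_pro_coproduct K D X X (fam_pid X) _ _ (dc_inj C X)
      (dc_inj C X) (pid (dc_ob C X)) (@unit_leg K D X _ (dc_inj C X))) ->
  is_pseudo Σ.
Proof.
move=> hmul hunit; split.
- move=> X Y Z M N; apply: (pro_coproduct_invertible (hmul X Y Z M N)).
  exact: (@sigma_mulE K D C X Y Z M N).
- move=> X; apply: (pro_coproduct_invertible (hunit X)).
  exact: (@sigma_unitE K D C X).
Qed.

End SigmaAdjoint.

(** * Coproducts of spans *)

Section EltCoproduct.
Context (S : Cat) (I J : SET) (A : set_span I J).

(** The universal property of a coproduct over the apex of [A], with the endpoints
of each index free.  Families of spans have apexes depending on the endpoints, and
an index of a composite has endpoints that match only propositionally. *)
Definition is_elt_coproduct (x : forall i j, elt A i j -> S) (c : S)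
    (ι : forall i j (e : elt A i j), hom (x i j e) c) : Prop :=
  forall (z : S) (k : forall i j (e : elt A i j), hom (x i j e) z),
    exists! h : hom c z, forall i j (e : elt A i j), ι i j e ;; h = k i j e.

Lemma elt_coproductP (x : forall i j, elt A i j -> S) (c : S)
    (ι : forall i j (e : elt A i j), hom (x i j e) c) :
  is_coproduct (fun a => ι _ _ (@Elt _ _ A _ _ a erefl erefl)) <-> is_elt_coproduct ι.
Proof.
split=> H z k.
  have [h [hE hu]] := H z (fun a => k _ _ (@Elt _ _ A _ _ a erefl erefl)).
  exists h; split=> [i j e | h' h'E]; first by destruct e as [a [] []]; exact: hE.
  by apply: hu => a; exact: h'E.
pose k' i j (e : elt A i j) : hom (x i j e) z :=
  match e with
  | @Elt _ _ _ _ _ a p q =>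
    match p in _ = i', q in _ = j' return hom (x i' j' (Elt p q)) z with
    | eq_refl, eq_refl => k a
    end
  end.
have [h [hE hu]] := H z k'.
exists h; split=> [a | h' h'E]; first exact: (hE _ _ (Elt erefl erefl)).
by apply: hu => i j e; destruct e as [a [] []]; exact: h'E.
Qed.

Lemma stable_elt_coproduct (K : SetClass) (x : forall i j, elt A i j -> S) (c : S)
    (ι : forall i j (e : elt A i j), hom (x i j e) c) (y : S) (f : hom y c)
    (p : forall i j, elt A i j -> S) (u : forall i j (e : elt A i j), hom (p i j e) y)
    (v : forall i j (e : elt A i j), hom (p i j e) (x i j e)) :
  stable_coproducts K S -> K (ss_apex A) -> is_elt_coproduct ι ->
  (forall i j (e : elt A i j), is_pullback f (ι i j e) (u i j e) (v i j e)) ->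
  is_elt_coproduct u.
Proof.
move=> st KA /elt_coproductP ιP pbu; apply/elt_coproductP.
by apply: (st _ _ _ _ KA ιP y f _ _ (fun a => v _ _ (Elt erefl erefl))) => a; exact: pbu.
Qed.

End EltCoproduct.

(** An initial object is the coproduct of the empty family, and stability pulls it
back along [f] to the coproduct of the empty family.  Stability concerns index
sets of the class [K], so the empty one is passed as [I]. *)
Lemma strict_initial (K : SetClass) (S : Cat) (P : Pullbacks S) (I : SET)
    (w v : S) (f : hom v w) :
  stable_coproducts K S -> K I -> (I -> False) -> is_initial w -> is_initial v.
Proof.
move=> st KI nI wI.
have wP : is_coproduct (fun i : I => False_rect (hom w w) (nI i)).
  move=> z k; have [h [_ hu]] := wI z; exists h; split=> [i|h' _]; first by case: (nI i).
  exact: hu.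
have vP := st I _ w _ KI wP v f _ (fun i => pb1 (P _ _ _ f (False_rect _ (nI i)))) _
  (fun i => pbP (P _ _ _ f _)).
move=> z; have [h [_ hu]] := vP z (fun i => False_rect _ (nI i)).
by exists h; split=> // h' _; apply: hu => i; case: (nI i).
Qed.

(** The double category of spans with its laws behind opaque constants, so that
unfolding it exposes the operations only.  By proof irrelevance it is [Span P]. *)
Definition sealed_span (S : Cat) (P : Pullbacks S) : DblCat.
Proof.
unshelve refine (@MkDblCat (span_data P) _ _ _ _ _ _ _ _ _ _ _ _ _ _ _ _ _ _).
- abstract exact (@vcomp_idl (Span P)).
- abstract exact (@vcomp_idr (Span P)).
- abstract exact (@vcomp_assoc (Span P)).
- abstract exact (@ucell_id (Span P)).
- abstract exact (@ucell_comp (Span P)).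
- abstract exact (@hcomp_id (Span P)).
- abstract exact (@hcomp_comp (Span P)).
- abstract exact (@assoc_nat (Span P)).
- abstract exact (@lun_nat (Span P)).
- abstract exact (@run_nat (Span P)).
- abstract exact (@assocK (Span P)).
- abstract exact (@assocVK (Span P)).
- abstract exact (@lunK (Span P)).
- abstract exact (@lunVK (Span P)).
- abstract exact (@runK (Span P)).
- abstract exact (@runVK (Span P)).
- abstract exact (@pentagon (Span P)).
- abstract exact (@triangle (Span P)).
Defined.

Lemma DblCat_ext (D E : DblCat) : dbldata D = dbldata E -> D = E.
Proof.
destruct D as [d], E as [e] => /= de; subst e.
repeat match goal with a : ?T, b : ?T |- _ =>
  rewrite (proof_irrelevance T a b); clear a end.
by [].
Qed.

Lemma Span_sealed (S : Cat) (P : Pullbacks S) : Span P = sealed_span P.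
Proof. exact: DblCat_ext. Qed.

Section SpanCoproducts.
Context (S : Cat) (P : Pullbacks S) (K : SetClass).
Implicit Types X Y Z : fam_ob K (sealed_span P).

Lemma span_map_ext (x y x' y' : S) (m : span x y) (n : span x' y') f g
    (α β : span_map m n f g) : sm_map α = sm_map β -> α = β.
Proof. by move=> e; apply: (@Sq_inj (sealed_span P)); exact: span_map_eq. Qed.

(** A map of apexes induced by a coproduct commutes with the legs because it does so
on each summand. *)
Lemma span_pro_coproduct X Y (M : fam_pro X Y) (c d : S)
    (ιX : forall i, hom (X i) c) (ιY : forall j, hom (Y j) d) (m : span c d)
    (ι : forall i j (e : elt (fp_span M) i j), span_map (fp_pro e) m (ιX i) (ιY j)) :
  is_elt_coproduct (fun i j e => sm_map (ι i j e)) ->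
  @is_pro_coproduct K (sealed_span P) X Y M c d ιX ιY m ι.
Proof.
move=> ιP z w n u v κ.
have [h [hE hu]] := ιP _ (fun i j e => sm_map (κ i j e)).
have ext z' (a b : hom (sp_apex m) z') :
    (forall i j e, sm_map (ι i j e) ;; a = sm_map (ι i j e) ;; b) -> a = b.
  by move=> e; apply: (unique_ex_eq (ιP _ (fun i j e => sm_map (ι i j e) ;; b))).
have hl : h ;; sp_l n = sp_l m ;; u.
  apply: ext => i j e; rewrite -!comp_assoc hE (sm_l (κ i j e)) (sm_l (ι i j e)).
  by rewrite comp_assoc.
have hr : h ;; sp_r n = sp_r m ;; v.
  apply: ext => i j e; rewrite -!comp_assoc hE (sm_r (κ i j e)) (sm_r (ι i j e)).
  by rewrite comp_assoc.
exists (MkSpanMap hl hr); split=> [i j e|α αE].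
  by apply: span_map_ext; exact: hE.
by apply: span_map_ext; apply: hu => i j e; rewrite -αE.
Qed.

Lemma chosen_coproduct (I : SET) (x : I -> S) : has_coproducts K S -> K I ->
  {c : S & {inj : forall i, hom (x i) c | is_coproduct inj}}.
Proof.
move=> H KI; have [c hc] := constructive_indefinite_description _ (H I x KI).
by exists c; exact: constructive_indefinite_description.
Qed.

Section Chosen.
Hypothesis H : has_coproducts K S.

Definition span_dc_ob X : S := projT1 (chosen_coproduct X H (fam_idxP X)).
Definition span_dc_inj X : forall i, hom (X i) (span_dc_ob X) :=
  proj1_sig (projT2 (chosen_coproduct X H (fam_idxP X))).
Lemma span_dc_injP X : is_coproduct (@span_dc_inj X).
Proof. exact: (proj2_sig (projT2 (chosen_coproduct X H (fam_idxP X)))). Qed.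

Section Pro.
Context (X Y : fam_ob K (sealed_span P)) (M : fam_pro X Y).
Let pt (a : ss_apex (fp_span M)) : span (X (ss_l a)) (Y (ss_r a)) :=
  fp_pro (@Elt _ _ (fp_span M) _ _ a erefl erefl).
Let apex := chosen_coproduct (fun a => sp_apex (pt a)) H (fp_spanP M).
Let leg : forall a, hom (sp_apex (pt a)) (projT1 apex) := proj1_sig (projT2 apex).
Let legP : is_coproduct leg := proj2_sig (projT2 apex).

Definition span_dc_pro : span (span_dc_ob X) (span_dc_ob Y) :=
  @MkSpan S _ _ (projT1 apex)
    (copair legP (fun a => sp_l (pt a) ;; span_dc_inj (ss_l a)))
    (copair legP (fun a => sp_r (pt a) ;; span_dc_inj (ss_r a))).

Definition span_dc_pinj i j (e : elt (fp_span M) i j) :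
    span_map (fp_pro e) span_dc_pro (@span_dc_inj X i) (@span_dc_inj Y j).
Proof. by destruct e as [a [] []]; exists (leg a); exact: copairE. Defined.

Lemma span_dc_pinj_apex : is_elt_coproduct (fun i j e => sm_map (@span_dc_pinj i j e)).
Proof. apply/elt_coproductP; exact: legP. Qed.

End Pro.

Definition span_coproducts : DblCoproducts K (sealed_span P) :=
  @MkDblCoproducts K (sealed_span P) span_dc_ob span_dc_inj span_dc_injP
    span_dc_pro span_dc_pinj
    (fun X Y M => span_pro_coproduct (@span_dc_pinj_apex X Y M)).

End Chosen.

(** * Composite spans in an extensive category *)

Section Composite.
Context (X Y Z : fam_ob K (sealed_span P)) (M : fam_pro X Y) (N : fam_pro Y Z).
Context (cX cY cZ : S).
Context (ιX : forall i, hom (X i) cX) (ιY : forall j, hom (Y j) cY).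
Context (ιZ : forall l, hom (Z l) cZ) (m : span cX cY) (n : span cY cZ).
Context (α : forall i j (a : elt (fp_span M) i j), span_map (fp_pro a) m (ιX i) (ιY j)).
Context (β : forall j l (b : elt (fp_span N) j l), span_map (fp_pro b) n (ιY j) (ιZ l)).

Let R := P (sp_r m) (sp_l n).

(** For an arbitrary pair of indices, the part of [R] lying over the summand of [a]
in [m] and over the summand of [b] in [n].  It is built by pulling back along
[a] first and along [b] next, as the two uses of stability do, but it is
characterised by [piece_ext] and [piece_med] as a pullback over the coproduct of
[Y]. *)
Section Piece.
Context (i : fam_idx X) (j j' : fam_idx Y) (l : fam_idx Z).
Context (a : elt (fp_span M) i j) (b : elt (fp_span N) j' l).

Definition pieceM := P (pb1 R) (sm_map (α a)).
Definition piece := P (pb1 pieceM ;; pb2 R) (sm_map (β b)).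
Definition piece1 : hom (pb piece) (sp_apex (fp_pro a)) := pb1 piece ;; pb2 pieceM.
Definition piece2 : hom (pb piece) (sp_apex (fp_pro b)) := pb2 piece.

Lemma piece_comm : piece1 ;; sp_r (fp_pro a) ;; ιY j = piece2 ;; sp_l (fp_pro b) ;; ιY j'.
Proof.
rewrite !comp_assoc -(sm_r (α a)) -(sm_l (β b)).
rewrite -(comp_assoc (pb2 pieceM)) -(pb_comm P).
rewrite -(comp_assoc piece2) -(pb_comm P) !comp_assoc.
by rewrite (pb_comm P).
Qed.

Lemma piece_ext (w : S) (h k : hom w (pb piece)) :
  h ;; piece1 = k ;; piece1 -> h ;; piece2 = k ;; piece2 -> h = k.
Proof.
move=> e1 e2; apply: (pb_ext (P := P)) => //.
have {}e1 : h ;; pb1 piece ;; pb2 pieceM = k ;; pb1 piece ;; pb2 pieceM.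
  by rewrite !comp_assoc.
apply: (pb_ext (P := P)) => //; apply: (pb_ext (P := P)).
  rewrite !(comp_assoc _ (pb1 pieceM)) (pb_comm P).
  by rewrite -!(comp_assoc _ _ (sm_map (α a))) e1.
rewrite !(comp_assoc _ (pb1 pieceM)) !(comp_assoc _ (pb1 piece)) (pb_comm P).
by rewrite -!(comp_assoc _ _ (sm_map (β b))) e2.
Qed.

Lemma piece_med (w : S) (s : hom w (sp_apex (fp_pro a))) (t : hom w (sp_apex (fp_pro b))) :
  s ;; sp_r (fp_pro a) ;; ιY j = t ;; sp_l (fp_pro b) ;; ιY j' ->
  {h : hom w (pb piece) | h ;; piece1 = s /\ h ;; piece2 = t}.
Proof.
move=> e.
have eR : s ;; sm_map (α a) ;; sp_r m = t ;; sm_map (β b) ;; sp_l n.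
  by rewrite !comp_assoc sm_r sm_l -!comp_assoc.
have eM : pb_med P eR ;; pb1 R = s ;; sm_map (α a) by exact: pb_med1.
have eN : pb_med P eM ;; (pb1 pieceM ;; pb2 R) = t ;; sm_map (β b).
  by rewrite pb_med1A pb_med2.
exists (pb_med P eN); split; last exact: pb_med2.
by rewrite /piece1 pb_med1A pb_med2.
Qed.

(** The piece maps to the pullback of two distinct coprojections, which is
initial. *)
Lemma piece_initial :
  disjoint_coproducts K S -> stable_coproducts K S -> is_coproduct ιY ->
  j <> j' -> is_initial (pb piece).
Proof.
move=> dj st ιYP nj; have KY := fam_idxP Y.
have [_ /(_ j j' nj) dj'] := dj _ _ _ _ KY ιYP.
have wI := dj' _ _ _ (pbP (P (ιY j) (ιY j'))).
(* The pullback of the points j and j' is an empty set of the class, whatever the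
   class is. *)
have KE := class_spb (fun _ : unit => j) (fun _ : unit => j')
  (class_unit K) KY (class_unit K).
apply: (strict_initial P (pb_med P piece_comm) st KE _ wI).
by case=> _ k _ ej ej'; apply: nj; rewrite ej ej'.
Qed.

End Piece.

Section SamePiece.
Context (i : fam_idx X) (j : fam_idx Y) (l : fam_idx Z).
Context (a : elt (fp_span M) i j) (b : elt (fp_span N) j l).

Lemma from_composite_comm :
  pb1 (P (sp_r (fp_pro a)) (sp_l (fp_pro b))) ;; sp_r (fp_pro a) ;; ιY j =
  pb2 (P (sp_r (fp_pro a)) (sp_l (fp_pro b))) ;; sp_l (fp_pro b) ;; ιY j.
Proof. by rewrite pb_comm. Qed.

Definition from_composite :
    hom (pb (P (sp_r (fp_pro a)) (sp_l (fp_pro b)))) (pb (piece a b)) :=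
  proj1_sig (piece_med from_composite_comm).

(** Cancelling the mono coprojection of [Y j], a pullback over the coproduct is a
pullback over [Y j]. *)
Lemma from_composite_iso : is_mono (ιY j) ->
  exists g, from_composite ;; g = idm _ /\ g ;; from_composite = idm _.
Proof.
move=> mono; have [t1 t2] := proj2_sig (piece_med from_composite_comm).
rewrite -/from_composite in t1 t2.
have e := mono _ _ _ (piece_comm a b).
exists (pb_med P e); split.
  apply: (pb_ext (P := P)); rewrite comp_assoc comp_idl.
    by rewrite pb_med1.
  by rewrite pb_med2.
apply: piece_ext; rewrite comp_assoc comp_idl.
  by rewrite t1 pb_med1.
by rewrite t2 pb_med2.
Qed.

Lemma from_compositeE :
  from_composite ;; (pb1 (piece a b) ;; pb1 (pieceM a)) =
  sm_map (span_hcomp P (α a) (β b)).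
Proof.
have [t1 t2] := proj2_sig (piece_med from_composite_comm).
rewrite -/from_composite in t1 t2.
apply: (pb_ext (P := P)); rewrite /= ?pb_med1 ?pb_med2.
  by rewrite !comp_assoc (pb_comm P) -t1 /piece1 !comp_assoc.
by rewrite !comp_assoc (pb_comm P) -t2 /piece2 !comp_assoc.
Qed.

End SamePiece.

Section Descent.
Context (z : S).
Context (k : forall i j l (a : elt (fp_span M) i j) (b : elt (fp_span N) j l),
  hom (pb (P (sp_r (fp_pro a)) (sp_l (fp_pro b)))) z).

(** A map out of a piece must restrict to the prescribed map on the apex of the
composite when the two indices can be composed; otherwise nothing is asked of it.
The match on [E] identifies the endpoints. *)
Definition extends i j j' l (a : elt (fp_span M) i j) (b : elt (fp_span N) j' l)
    (q : hom (pb (piece a b)) z) : Prop :=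
  forall E : j = j',
    match E in _ = j0
      return forall b : elt (fp_span N) j0 l, hom (pb (piece a b)) z -> Prop with
    | eq_refl => fun b q => from_composite a b ;; q = k a b
    end b q.

Arguments extends {i j j' l} a b q.

Lemma extends_unique i j j' l (a : elt (fp_span M) i j) (b : elt (fp_span N) j' l) :
  disjoint_coproducts K S -> stable_coproducts K S -> is_coproduct ιY ->
  exists! q, extends a b q.
Proof.
move=> dj st ιYP.
case: (classic (j = j')) => [E|nE]; last first.
  have [q [_ qu]] := piece_initial a b dj st ιYP nE z.
  by exists q; split=> [E|q' _]; [case: (nE E) | exact: qu].
subst j'.
have [mono _] := dj _ _ _ _ (fam_idxP Y) ιYP.
have [g [tg gt]] := from_composite_iso a b (mono j).
exists (g ;; k a b); split=> [E|q /(_ erefl) qE].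
  by rewrite (proof_irrelevance _ E erefl) -comp_assoc tg comp_idl.
by rewrite -qE -comp_assoc gt comp_idl.
Qed.

End Descent.

(** A map out of [R] amounts to maps out of all the pieces, by stability used twice,
and these are determined by their restrictions to the composable pairs. *)
Lemma composite_coproduct :
  disjoint_coproducts K S -> stable_coproducts K S -> is_coproduct ιY ->
  is_elt_coproduct (fun i j e => sm_map (@α i j e)) ->
  is_elt_coproduct (fun j l e => sm_map (@β j l e)) ->
  is_elt_coproduct (A := fp_span (fam_pcomp M N))
    (fun i l e => sm_map (span_hcomp P (α (elt_fst e)) (β (elt_snd e)))).
Proof.
move=> dj st ιYP αP βP.
have RP : is_elt_coproduct (fun i j (a : elt (fp_span M) i j) => pb1 (pieceM a)).
  apply: (stable_elt_coproduct st (fp_spanP M) αP) => i j a; exact: pbP.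
have MP i j (a : elt (fp_span M) i j) :
    is_elt_coproduct (fun j' l (b : elt (fp_span N) j' l) => pb1 (piece a b)).
  apply: (stable_elt_coproduct st (fp_spanP N) βP) => j' l b; exact: pbP.
move=> z k0.
(* The apex indexed by a pair of elements is the pullback in the type of [k] only
   once both elements are constructors. *)
pose k i j l (a : elt (fp_span M) i j) (b : elt (fp_span N) j l) :
    hom (pb (P (sp_r (fp_pro a)) (sp_l (fp_pro b)))) z :=
  match a, b return hom (pb (P (sp_r (fp_pro a)) (sp_l (fp_pro b)))) z with
  | @Elt _ _ _ _ _ a p ea, @Elt _ _ _ _ _ b eb q =>
    k0 i l (elt_pair (Elt p ea) (Elt eb q))
  end.
have kE i l (e : elt (fp_span (fam_pcomp M N)) i l) :
    k _ _ _ (elt_fst e) (elt_snd e) = k0 i l e.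
  by case: e => [[a j b ea eb] p q].
pose q i j j' l (a : elt (fp_span M) i j) (b : elt (fp_span N) j' l) :=
  constructive_definite_description _ (extends_unique k a b dj st ιYP).
pose Mh i j a := constructive_definite_description _
  (MP i j a z (fun j' l b => proj1_sig (q i j j' l a b))).
have [h [hE hu]] := RP z (fun i j a => proj1_sig (Mh i j a)).
have legE i j l (a : elt (fp_span M) i j) (b : elt (fp_span N) j l) :
    sm_map (span_hcomp P (α a) (β b)) ;; h = k i j l a b.
  rewrite -from_compositeE !comp_assoc hE (proj2_sig (Mh i j a)).
  exact: (proj2_sig (q i j j l a b) erefl).
exists h; split=> [i l e|h' h'E]; first by rewrite -kE; exact: legE.
apply: hu => i j a.
apply: (unique_ex_eq (MP i j a z (fun j' l b => proj1_sig (q i j j' l a b)))); last first.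
  exact: (proj2_sig (Mh i j a)).
move=> j' l b; apply: (unique_ex_eq (extends_unique k a b dj st ιYP)); last first.
  exact: (proj2_sig (q i j j' l a b)).
move=> E; destruct E; rewrite -!comp_assoc (comp_assoc (from_composite a b)) from_compositeE.
destruct a as [a p ea], b as [b eb r].
exact: (h'E i l (elt_pair (@Elt _ _ (fp_span M) i j a p ea)
  (@Elt _ _ (fp_span N) j l b eb r))).
Qed.

End Composite.

Lemma unit_coproduct X (c : S) (ι : forall i, hom (X i) c) :
  is_coproduct ι ->
  is_elt_coproduct (A := fp_span (fam_pid X))
    (fun i j e => sm_map (@unit_leg K (sealed_span P) X c ι i j e)).
Proof. by move=> ιP; apply/elt_coproductP. Qed.

Lemma span_colax_coproducts : has_coproducts K S -> has_colax_K_coproducts K (sealed_span P).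
Proof. by move=> H; exists; exact: sigma_coproducts (span_coproducts H). Qed.

Lemma span_strong_coproducts : extensive K S -> has_strong_K_coproducts K (sealed_span P).
Proof.
case=> H [dj st]; exists (sigma_coproducts (span_coproducts H)); apply: sigma_pseudo.
- move=> X Y Z M N; apply: span_pro_coproduct.
  apply: (composite_coproduct dj st (span_dc_injP H (X := Y))); exact: span_dc_pinj_apex.
- move=> X; apply: span_pro_coproduct; apply: unit_coproduct; exact: span_dc_injP.
Qed.

End SpanCoproducts.

Theorem theorem4p3 (S : Cat) (P : Pullbacks S) :
  (has_coproducts all_sets S ->
    has_colax_coproducts (Span P) /\
    (infinitary_extensive S -> has_strong_coproducts (Span P))) /\
  (has_coproducts finite_sets S ->
    has_colax_finite_coproducts (Span P) /\
    (finitary_extensive S -> has_strong_finite_coproducts (Span P))).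
Proof.
rewrite Span_sealed; split=> H; split; try exact: span_colax_coproducts.
  exact: span_strong_coproducts.
exact: span_strong_coproducts.
Qed.
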